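(* Let $d\ge 1$ be an integer, let $X_0,\ldots,X_d$ be independent random points in $\mathbb{R}^d$, each with the standard Gaussian distribution, and let $\mathcal{P}_d:=\operatorname{conv}(X_0,\ldots,X_d)$ be the $d$-dimensional Gaussian simplex (with probability one a non-degenerate $d$-dimensional simplex). Let $T^d:=\operatorname{conv}(e_0,\ldots,e_d)\subset\mathbb{R}^{d+1}$ be the regular $d$-dimensional simplex, where $e_0,\ldots,e_d$ is the standard orthonormal basis of $\mathbb{R}^{d+1}$. Then the expected sum of the solid angles of the Gaussian simplex equals the sum of the solid angles of the regular simplex: $$\mathbb{E}\,\gamma_d(\mathcal{P}_d)=\gamma_d(T^d).$$
   Context: The standard Gaussian distribution on $\mathbb{R}^d$ has Lebesgue density $f(x)=(2\pi)^{-d/2}e^{-|x|^2/2}$, where $|x|$ is the Euclidean norm. For vectors $v_1,\ldots,v_m\in\mathbb{R}^n$, the positive hull is $\operatorname{pos}(v_1,\ldots,v_m):=\{\sum_{i=1}^m\lambda_i v_i:\lambda_1,\ldots,\lambda_m\ge 0\}$; a (polyhedral) cone is the positive hull of finitely many vectors. Its dimension is the dimension of its linear hull $\operatorname{lin}(C)$ (the minimal linear subspace containing $C$). For a cone $C\subset\mathbb{R}^n$ of dimension $k$, the solid angle is $\alpha_k(C):=\mathbb{P}[Z'\in C]$, where $Z'$ is uniformly distributed on the unit sphere of the linear hull of $C$ (so the full solid angle equals $1$). Let $x_0,\ldots,x_d\in\mathbb{R}^n$, $n\ge d$, be points whose affine span has dimension $d$, and let $S=\operatorname{conv}(x_0,\ldots,x_d)$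 be the $d$-dimensional simplex with these vertices. The solid angle of $S$ at $x_i$ is $\alpha_d(S,x_i):=\alpha_d(\operatorname{pos}(x_0-x_i,x_1-x_i,\ldots,x_d-x_i))$, and the sum of the solid angles of $S$ is $\gamma_d(S):=\sum_{i=0}^d\alpha_d(S,x_i)$. *)

(* Defs.v *)
From HB Require Import structures.
From mathcomp Require Import all_boot all_order all_algebra.
From mathcomp Require Import all_classical all_reals all_analysis.

Set Implicit Arguments.
Unset Strict Implicit.
Unset Printing Implicit Defensive.

Import Order.TTheory GRing.Theory Num.Theory.
Import numFieldNormedType.Exports.

Local Open Scope classical_set_scope.
Local Open Scope ring_scope.

(** The Borel sigma-algebra of R^n, presented (as the library does for tuples)
    as the product sigma-algebra generated by the coordinate maps. *)
Definition rV_display : measure_display -> measure_display.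
Proof. exact. Qed.

Section measurable_rV.
Variables (R : realType) (n : nat).

Definition rV_coord (i : 'I_n) (x : 'rV[R]_n) : R := x ord0 i.

Let rV_set0 : g_sigma_preimage rV_coord set0.
Proof. exact: sigma_algebra0. Qed.

Let rV_setC A : g_sigma_preimage rV_coord A ->
  g_sigma_preimage rV_coord (~` A).
Proof. exact: sigma_algebraC. Qed.

Let rV_bigcup (F : (set 'rV[R]_n)^nat) :
  (forall i, g_sigma_preimage rV_coord (F i)) ->
  g_sigma_preimage rV_coord (\bigcup_i (F i)).
Proof. exact: sigma_algebra_bigcup. Qed.

HB.instance Definition _ := @isMeasurable.Build (rV_display default_measure_display)
  'rV[R]_n (g_sigma_preimage rV_coord) rV_set0 rV_setC rV_bigcup.

End measurable_rV.

Section measurable_rV_theory.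
Variable R : realType.

Lemma measurable_rV_coord n (i : 'I_n) :
  measurable_fun [set: 'rV[R]_n] (@rV_coord R n i).
Proof.
move=> _ Y mY; rewrite setTI; apply: sub_sigma_algebra => /=.
rewrite -bigcup_seq/=; exists i => /=; first by rewrite mem_index_enum.
by exists Y => //; rewrite setTI.
Qed.

Lemma measurable_fun_rV d (T : measurableType d) n (f : T -> 'rV[R]_n) :
  (forall i, measurable_fun [set: T] (fun t => f t ord0 i)) ->
  measurable_fun [set: T] f.
Proof.
move=> mf.
suff H : g_sigma_preimage (fun i => @rV_coord R n i \o f) `<=` measurable.
  move=> _ A mA; rewrite setTI; apply: H.
  by rewrite g_sigma_preimage_comp; exists A => //; rewrite setTI.
apply: smallest_sub; first exact: sigma_algebra_measurable.
rewrite -bigcup_seq => A /= [i _] [B mB <-].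
exact: (mf i).
Qed.

Definition rV_cons n (p : R * 'rV[R]_n) : 'rV[R]_n.+1 := row_mx (p.1)%:M p.2.

Definition rV_uncons n (x : 'rV[R]_n.+1) : R * 'rV[R]_n :=
  (x ord0 ord0, \row_i x ord0 (lift ord0 i)).

Lemma rV_consK n : cancel (@rV_cons n) (@rV_uncons n).
Proof.
move=> [a v]; congr pair => /=.
  have -> : ord0 = lshift n (ord0 : 'I_1) by exact: ord_inj.
  by rewrite /rV_cons [LHS]row_mxEl mxE.
apply/rowP => i; rewrite mxE /rV_cons.
have -> : lift ord0 i = rshift 1 i by exact: ord_inj.
by rewrite [LHS]row_mxEr.
Qed.

Lemma measurable_rV_cons n : measurable_fun [set: R * 'rV[R]_n] (@rV_cons n).
Proof.
apply: measurable_fun_rV => i.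
case: (splitP (i : 'I_(1 + n))) => j ij.
- have -> : i = lshift n j by exact: ord_inj.
  apply: eq_measurable_fun (@measurable_fst _ _ R 'rV[R]_n) => -[a v] _ /=.
  by rewrite /rV_cons [RHS]row_mxEl mxE (ord1 j).
- have -> : i = rshift 1 j by exact: ord_inj.
  apply: eq_measurable_fun (measurableT_comp (measurable_rV_coord j)
    (@measurable_snd _ _ R 'rV[R]_n)) => -[a v] _ /=.
  by rewrite /rV_cons [RHS]row_mxEr.
Qed.

Lemma measurable_rV_uncons n : measurable_fun [set: 'rV[R]_n.+1] (@rV_uncons n).
Proof.
apply/measurable_fun_pairP; split; first exact: measurable_rV_coord.
apply: measurable_fun_rV => i.
apply: eq_measurable_fun (measurable_rV_coord (lift ord0 i)) => x _ /=.
by rewrite mxE.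
Qed.

Section lebesgue_cons.
Variables (n : nat) (m : {sigma_finite_measure set 'rV[R]_n -> \bar R}).

Definition lebesgue_cons : set 'rV[R]_n.+1 -> \bar R :=
  pushforward (@lebesgue_measure R \x m)%E (@rV_cons n).

Let lebesgue_cons0 : lebesgue_cons set0 = 0%E.
Proof. by rewrite /lebesgue_cons /pushforward preimage_set0 measure0. Qed.

Let lebesgue_cons_ge0 A : (0 <= lebesgue_cons A)%E.
Proof. by rewrite /lebesgue_cons /pushforward; exact: measure_ge0. Qed.

Let lebesgue_cons_sigma_additive : semi_sigma_additive lebesgue_cons.
Proof.
move=> F mF tF mUF; rewrite /lebesgue_cons /pushforward preimage_bigcup.
have mpre A : measurable A -> measurable (@rV_cons n @^-1` A).
  by move=> mA; rewrite -[X in measurable X]setTI; exact: measurable_rV_cons.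
apply: measure_semi_sigma_additive.
- by move=> k; exact: mpre.
- apply/trivIsetP => /= i j _ _ ij; rewrite -preimage_setI.
  by move/trivIsetP : tF => /(_ _ _ _ _ ij) ->//; rewrite preimage_set0.
- by rewrite -preimage_bigcup; exact: mpre.
Qed.

HB.instance Definition _ := isMeasure.Build _ _ _ lebesgue_cons
  lebesgue_cons0 lebesgue_cons_ge0 lebesgue_cons_sigma_additive.

Let lebesgue_cons_sigma_finite : sigma_finite setT lebesgue_cons.
Proof.
have /sigma_finiteP[F [FT ndF Foo]] := sigma_finiteT (@lebesgue_measure R).
have /sigma_finiteP[G [GT ndG Goo]] := sigma_finiteT m.
exists (fun k => @rV_uncons n @^-1` (F k `*` G k)).
  rewrite -preimage_bigcup [X in _ @^-1` X](_ : _ = setT) ?preimage_setT//.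
  rewrite -setXTT FT GT predeqE => -[x y]; split.
    by move=> [k _ []/= ? ?]; split; exists k.
  move=> [/= [k _ Fkx] [l _ Gly]]; exists (maxn k l) => //; split.
  - by move: x Fkx; exact/subsetPset/ndF/leq_maxl.
  - by move: y Gly; exact/subsetPset/ndG/leq_maxr.
move=> k; have [mF Fk] := Foo k; have [mG Gk] := Goo k; split.
  rewrite -[X in measurable X]setTI; apply: measurable_rV_uncons => //.
  exact: measurableX.
rewrite /lebesgue_cons /pushforward -comp_preimage.
rewrite [X in X @^-1` _](_ : _ = id); last first.
  by apply/funext => p; exact: rV_consK.
by rewrite preimage_id product_measure1E// lte_mul_pinfty// ge0_fin_numE.
Qed.

HB.instance Definition _ := Measure_isSigmaFinite.Build _ _ _ lebesgue_cons
  lebesgue_cons_sigma_finite.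

End lebesgue_cons.

End measurable_rV_theory.

(** n-dimensional Lebesgue measure: the n-fold product of [lebesgue_measure]. *)
Fixpoint lebesgue_rV (R : realType) (n : nat) :
    {sigma_finite_measure set 'rV[R]_n -> \bar R} :=
  if n is n'.+1 then lebesgue_cons (lebesgue_rV R n') else \d_(0 : 'rV[R]_0).

Section solid_angle.
Variables (R : realType) (n : nat).
Implicit Types (C U : set 'rV[R]_n) (x : 'rV[R]_n).

(** Not [`|x|], which on matrices is the max norm. *)
Definition enorm x : R := Num.sqrt (\sum_(i < n) x ord0 i ^+ 2).

Definition pos m (v : 'I_m -> 'rV[R]_n) : set 'rV[R]_n :=
  [set y | exists2 l : 'I_m -> R,
     forall i, 0 <= l i & y = \sum_(i < m) l i *: v i].

Definition linear_subspace U : Prop :=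
  U 0 /\ forall (a : R) x y, U x -> U y -> U (a *: x + y).

Definition lin C : set 'rV[R]_n := smallest linear_subspace C.

Definition unit_sphere U : set 'rV[R]_n := [set x | U x /\ enorm x = 1].

(** The uniform distribution on the unit sphere of [U]: the probability measure
    carried by that sphere which is invariant under the linear isometries of
    [U]; each of these extends to an orthogonal matrix (acting on the right of
    row vectors) that maps [U] into itself.  It exists and is unique as soon as
    [U] is a subspace other than {0}. *)
Definition uniform_on_unit_sphere U (mu : probability 'rV[R]_n R) : Prop :=
  mu (unit_sphere U) = 1%E /\
  forall Q : 'M[R]_n, Q *m Q^T = 1%:M -> (forall x, U x -> U (x *m Q)) ->
  forall A : set 'rV[R]_n, measurable A ->
    mu ((fun x => x *m Q) @^-1` A) = mu A.

(** The point mass is a default value, only reached when [U] = {0}, whose unit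
    sphere is empty. *)
Definition uniform_sphere U : probability 'rV[R]_n R :=
  xget [the probability _ R of \d_(0 : 'rV[R]_n)] (uniform_on_unit_sphere U).

Definition solid_angle C : R := fine (uniform_sphere (lin C) C).

(** A simplex is given by the family [x] of its vertices. *)
Definition solid_angle_at d (x : 'I_d.+1 -> 'rV[R]_n) (i : 'I_d.+1) : R :=
  solid_angle (pos (fun j => x j - x i)).

Definition solid_angle_sum d (x : 'I_d.+1 -> 'rV[R]_n) : R :=
  \sum_(i < d.+1) solid_angle_at x i.

End solid_angle.

(** [T^d] = conv(e_0, ..., e_d) in R^(d+1), given by its vertices. *)
Definition regular_simplex (R : realType) (d : nat) :
  'I_d.+1 -> 'rV[R]_d.+1 := fun i => delta_mx ord0 i.

Definition gaussian_density (R : realType) (d : nat) (x : 'rV[R]_d) : R :=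
  (2 * pi) `^ (- (d%:R / 2)) * expR (- (enorm x ^+ 2 / 2)).

Section random_vectors.
Variables (dT : measure_display) (T : measurableType dT) (R : realType).
Variable P : probability T R.

Definition standard_gaussian d (X : {RV P >-> 'rV[R]_d}) : Prop :=
  forall A : set 'rV[R]_d, measurable A ->
    distribution P X A =
      (\int[lebesgue_rV R d]_(x in A) (gaussian_density x)%:E)%E.

Definition independent (I : finType) d (X : I -> {RV P >-> 'rV[R]_d}) : Prop :=
  forall (J : {set I}) (A : I -> set 'rV[R]_d),
    (forall i, measurable (A i)) ->
    P (\bigcap_(i in [set` J]) X i @^-1` A i) =
      (\prod_(i in J) P (X i @^-1` A i))%E.

End random_vectors.

(* Main.v *)
Require Import Defs.
From HB Require Import structures.
From mathcomp Require Import all_boot all_order all_algebra.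
From mathcomp Require Import all_classical all_reals all_analysis.
From mathcomp Require Import measurable_realfun.
From mathcomp Require Import ring lra.

Set Implicit Arguments.
Unset Strict Implicit.
Unset Printing Implicit Defensive.

Import Order.TTheory GRing.Theory Num.Theory.
Import numFieldNormedType.Exports.

Local Open Scope classical_set_scope.
Local Open Scope ring_scope.

(** For each vertex separately, the expected solid angle of the Gaussian simplex
    at [X_i] equals the solid angle of the regular simplex at [e_i].

    Let [Y] be the square matrix whose rows are the edges [X_j - X_i], and let
    [z] be a nonzero vector of R^d.  Almost surely [Y] is invertible
    ([gaussian_prob_det0]), and [z] lies in the cone at [X_i] if and only if its
    coordinates [a = z *m Y^-1] in the basis of the edges are nonnegative.  Let
    [c] be the vector with the same coordinates [a] in the basis [e_j - e_i] of
    the hyperplane H of R^(d+1) where the coordinates sum to 0.  It is the only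
    vector of H with [c *m M = z], where [M] is the matrix of the points [X_j].
    An isometry Q of H, extended to R^(d+1), replaces [c] by [c *m Q^-1] when
    [M] is replaced by [Q *m M], and [Q *m M] has the same law as [M]: hence the
    direction of [c] is uniform on the unit sphere of H ([uniform_edge_coord]).
    Now [a] is nonnegative if and only if [c] lies in the cone of the regular
    simplex at [e_i], so this has a probability equal to the solid angle of the
    regular simplex, whatever [z] ([gaussian_prob_edge_coord_ge0]).  Averaging
    over a uniform [z] on the unit sphere of R^d and exchanging the integrals
    gives the theorem ([integral_angle_at]).

    Two facts of measure theory carry this argument.  The first is the invariance
    of Gaussian measure under linear isometries ([gaussian_prob_isometry]), which
    is deduced from the invariance of Lebesgue measure under translations by
    computing a double integral in two ways, as in the proof that a Haar measure
    is unique.  It also gives the existence of the uniform distribution on the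
    unit sphere of R^d, as the direction of a Gaussian vector; on that of H, the
    direction of [c] has it.  The second is the uniqueness
    of the uniform distribution ([uniform_on_unit_sphere_unique]): two invariant
    probability measures give the same mass to all balls of a given radius
    centred on the sphere, and comparing them on small balls shows that they
    agree on relatively open sets.  By independence, the (d+1) * d coordinates of all
    the points form one standard Gaussian vector ([joint_row_law]). *)

(** * Lebesgue measure is invariant under translations *)

Lemma integral_lebesgue_shift (R : realType) (a : R) (f : R -> \bar R) :
  measurable_fun [set: R] f -> (forall x, 0 <= f x)%E ->
  (\int[lebesgue_measure]_x f (x + a)%R = \int[lebesgue_measure]_x f x)%E.
Proof.
move=> mf f0.
have mD : measurable_fun [set: measurableTypeR R] (fun x : R => x + a : measurableTypeR R).
  exact: measurable_funD.
pose D_mixin := isMeasurableFun.Build _ _ _ _ _ mD.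
pose D : {mfun measurableTypeR R >-> measurableTypeR R} :=
  HB.pack (fun x : R => x + a) D_mixin.
have shiftE (A : set (measurableTypeR R)) : measurable A ->
    pushforward (@lebesgue_measure R) D A = lebesgue_measure A.
  move=> mA; apply/esym/(@lebesgue_measure_unique _
    (pushforward (@lebesgue_measure R) D)) => //= _ [[b c]] _ <-.
  rewrite /pushforward/=.
  have -> : (fun x : R => x + a) @^-1` `]b, c]%classic = `]b - a, c - a]%classic.
    by apply/seteqP; split => x /=; rewrite !in_itv/= ltrBlDr lerBrDr.
  rewrite !lebesgue_measure_itv/= !lte_fin ltrD2r.
  by case: ifP => // _; rewrite -!EFinB opprB addrA subrK.
transitivity (\int[pushforward (@lebesgue_measure R) D]_x f x)%E; last first.
  by apply: eq_measure_integral => A mA _; exact: shiftE.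
by rewrite ge0_integral_pushforward.
Qed.

Lemma integral_lebesgue_rV_cons (R : realType) n (f : 'rV[R]_n.+1 -> \bar R) :
  measurable_fun setT f -> (forall x, 0 <= f x)%E ->
  (\int[lebesgue_rV R n.+1]_x f x =
   \int[lebesgue_measure]_a \int[lebesgue_rV R n]_v f (rV_cons (a, v)))%E.
Proof.
move=> mf f0.
rewrite [LHS](_ : _ = (\int[pushforward
  (@lebesgue_measure R \x lebesgue_rV R n)%E (@rV_cons R n)]_x f x)%E)//.
rewrite ge0_integral_pushforward//; last exact: measurable_rV_cons.
rewrite preimage_setT fubini_tonelli1//; last by move=> x; exact: f0.
by apply: measurableT_comp => //; exact: measurable_rV_cons.
Qed.

Lemma rV_consD (R : realType) n (p q : R * 'rV[R]_n) :
  rV_cons p + rV_cons q = rV_cons (p.1 + q.1, p.2 + q.2).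
Proof. by rewrite /rV_cons (@add_row_mx _ 1 1 n)/= raddfD. Qed.

Lemma rV_unconsK (R : realType) n : cancel (@rV_uncons R n) (@rV_cons R n).
Proof.
move=> x; apply/rowP => i; case: (splitP (i : 'I_(1 + n))) => j ij.
- have -> : i = lshift n j by exact: ord_inj.
  rewrite /rV_cons [LHS]row_mxEl mxE (ord1 j)/= mulr1n.
  by congr (x _ _); exact: ord_inj.
- have -> : i = rshift 1 j by exact: ord_inj.
  rewrite /rV_cons [LHS]row_mxEr mxE.
  by congr (x _ _); exact: ord_inj.
Qed.

Lemma measurable_rV_shift (R : realType) n (a : 'rV[R]_n) :
  measurable_fun setT (fun x : 'rV[R]_n => x + a).
Proof.
apply: measurable_fun_rV => i.
apply: eq_measurable_fun (measurable_funD (measurable_rV_coord i)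
  (measurable_cst (a ord0 i))) => x _ /=.
by rewrite mxE.
Qed.

Lemma integral_lebesgue_rV_shift (R : realType) n (a : 'rV[R]_n)
    (f : 'rV[R]_n -> \bar R) :
  measurable_fun setT f -> (forall x, 0 <= f x)%E ->
  (\int[lebesgue_rV R n]_x f (x + a)%R = \int[lebesgue_rV R n]_x f x)%E.
Proof.
elim: n => [|n IH] in a f *.
  by move=> _ _; apply: eq_integral => x _; rewrite [x]thinmx0 [a]thinmx0 addr0.
move=> mf f0; have mfcons : measurable_fun setT (f \o @rV_cons R n).
  by apply: measurableT_comp => //; exact: measurable_rV_cons.
rewrite [RHS]integral_lebesgue_rV_cons//.
rewrite -(@integral_lebesgue_shift _ (rV_uncons a).1); first last.
- by move=> x; apply: integral_ge0.
- exact: (measurable_fun_fubini_tonelli_F (m2 := lebesgue_rV R n)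
    (f \o @rV_cons R n) mfcons (fun x => f0 _)).
rewrite integral_lebesgue_rV_cons//; last first.
  by apply: measurableT_comp => //; exact: measurable_rV_shift.
apply: eq_integral => t _; rewrite -[RHS](IH (rV_uncons a).2)//; last first.
  by apply: measurableT_comp mfcons _; exact: measurable_pair1.
by apply: eq_integral => v _; rewrite -[in LHS](rV_unconsK a) rV_consD.
Qed.

(** * The standard Gaussian measure of a vector space of rows *)

Section gaussian_rV.
Variables (R : realType).
Implicit Types n : nat.

Lemma enormE n (x : 'rV[R]_n) : enorm x ^+ 2 = \sum_i x ord0 i ^+ 2.
Proof. by rewrite sqr_sqrtr// sumr_ge0// => i _; exact: sqr_ge0. Qed.

Lemma enormN n (x : 'rV[R]_n) : enorm (- x) = enorm x.
Proof.
by congr Num.sqrt; apply: eq_bigr => i _; rewrite mxE sqrrN.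
Qed.

Lemma measurable_enorm n : measurable_fun setT (@enorm R n).
Proof.
apply: measurableT_comp.
  by apply: continuous_measurable_fun; exact: sqrt_continuous.
by apply: measurable_sum => i; apply: measurable_funX; exact: measurable_rV_coord.
Qed.

Lemma gaussian_density_ge0 n (x : 'rV[R]_n) : 0 <= gaussian_density x.
Proof. by rewrite mulr_ge0// ?powR_ge0 ?expR_ge0. Qed.

Lemma measurable_gaussian_density n :
  measurable_fun setT (@gaussian_density R n).
Proof.
apply: measurable_funM => //; apply: measurableT_comp => //.
apply: measurableT_comp => //; apply: measurable_funM => //.
by apply: measurable_funX; exact: measurable_enorm.
Qed.

Lemma gaussian_density_cons n (a : R) (v : 'rV[R]_n) :
  gaussian_density (rV_cons (a, v)) = normal_pdf 0 1 a * gaussian_density v.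
Proof.
have consE (x : 'rV[R]_n.+1) : enorm x ^+ 2 =
    (rV_uncons x).1 ^+ 2 + enorm (rV_uncons x).2 ^+ 2.
  rewrite !enormE big_ord_recl/=; congr (_ + _).
  by apply: eq_bigr => i _; rewrite mxE.
have p0 : 0 < 2 * pi :> R by rewrite mulr_gt0// pi_gt0.
rewrite /gaussian_density consE rV_consK/=.
rewrite normal_pdfE ?oner_eq0// /normal_peak /normal_fun subr0 expr1n mul1r.
rewrite -[n.+1]addn1 natrD (mulrDl n%:R) opprD powRD; last first.
  by rewrite implybE orbC (gt_eqF p0).
rewrite (mulrDl (a ^+ 2)) opprD expRD (powRN _ (_%:R / 2)) mul1r.
rewrite (powRN _ 2^-1) powR12_sqrt ?(ltW p0)//.
rewrite (mulrC 2) mulr_natr mulNr; ring.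
Qed.

(** The set of the vectors whose [i]th coordinate lies in [B i]. *)
Definition box n (B : 'I_n -> set R) : set 'rV[R]_n :=
  [set x | forall i, B i (x ord0 i)].

Lemma measurable_box n (B : 'I_n -> set R) :
  (forall i, measurable (B i)) -> measurable (box B).
Proof.
move=> mB; rewrite (_ : box B = \bigcap_(i in [set: 'I_n])
    (@rV_coord R n i @^-1` B i)).
  apply: fin_bigcap_measurable => // i _; rewrite -[X in measurable X]setTI.
  exact: measurable_rV_coord.
by apply/seteqP; split => x h i; [move=> _; exact: h|exact: (h i I)].
Qed.

Lemma integral_gaussian_box n (B : 'I_n -> set R) :
  (forall i, measurable (B i)) ->
  (\int[lebesgue_rV R n]_(x in box B) (gaussian_density x)%:E =
   \prod_(i < n) normal_prob 0 1 (B i))%E.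
Proof.
move=> mB.
have int_boxE : forall m (C : 'I_m -> set R), (forall i, measurable (C i)) ->
    (\int[lebesgue_rV R m]_(x in box C) (gaussian_density x)%:E =
     \int[lebesgue_rV R m]_x (gaussian_density x * \1_(box C) x)%:E)%E.
  move=> m C mC; rewrite integral_mkcond; apply: eq_integral => x _.
  by rewrite patchE indicE; case: ifPn; rewrite ?mulr1 ?mulr0.
have mdens : forall m (C : 'I_m -> set R), (forall i, measurable (C i)) ->
    measurable_fun setT (fun x => (gaussian_density x * \1_(box C) x)%:E).
  move=> m C mC; apply/measurable_EFinP; apply: measurable_funM => //.
    exact: measurable_gaussian_density.
  by apply: measurable_indic; exact: measurable_box.
have dens_ge0 m (C : 'I_m -> set R) (x : 'rV[R]_m) :
    (0 <= (gaussian_density x * \1_(box C) x)%:E)%E.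
  by rewrite lee_fin mulr_ge0 ?gaussian_density_ge0// indicE.
rewrite int_boxE//; elim: n => [|n IH] in B mB *.
  rewrite big_ord0 integral_dirac//; last exact: mdens.
  rewrite diracT mul1e indicE mem_set ?mulr1; last by case.
  rewrite /gaussian_density /enorm big_ord0 sqrtr0 expr0n/= !mul0r !oppr0.
  by rewrite expR0 powRr0 mulr1.
rewrite integral_lebesgue_rV_cons//; last exact: mdens.
rewrite big_ord_recl.
pose B' i := B (lift ord0 i).
have mB' i : measurable (B' i) by exact: mB.
have boxE a (v : 'rV[R]_n) :
    \1_(box B) (rV_cons (a, v)) = \1_(B ord0) a * \1_(box B') v :> R.
  rewrite !indicE -natrM mulnb; congr (_%:R); congr (nat_of_bool _).
  have := rV_consK (a, v); rewrite /rV_uncons => -[h1 h2].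
  apply/idP/andP => [/set_mem h|[/set_mem ha /set_mem hv]].
    split; apply/mem_set; first by rewrite -h1; exact: h.
    move=> i; have -> : v ord0 i = rV_cons (a, v) ord0 (lift ord0 i).
      by rewrite -[in LHS]h2 mxE.
    exact: h.
  apply/mem_set => i; case: (unliftP ord0 i) => [j ->|->]; last by rewrite h1.
  have -> : rV_cons (a, v) ord0 (lift ord0 j) = v ord0 j.
    by rewrite -[in RHS]h2 mxE.
  exact: hv.
transitivity (\int[lebesgue_measure]_a ((normal_pdf 0 1 a * \1_(B ord0) a)%:E *
    \prod_(i < n) normal_prob 0 1 (B' i)))%E.
  apply: eq_integral => a _; rewrite -IH// -ge0_integralZl//.
  - apply: eq_integral => v _.
    by rewrite gaussian_density_cons boxE -EFinM mulrACA.
  - exact: mdens.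
  - by rewrite lee_fin mulr_ge0 ?normal_pdf_ge0// indicE.
rewrite ge0_integralZr//.
- congr (_ * _)%E; rewrite /normal_prob [RHS]integral_mkcond.
  apply: eq_integral => a _.
  by rewrite patchE indicE; case: ifPn; rewrite ?mulr1 ?mulr0.
- apply/measurable_EFinP/measurable_funM; first exact: measurable_normal_pdf.
  by apply: measurable_indic; exact: mB.
- by move=> a _; rewrite lee_fin mulr_ge0 ?normal_pdf_ge0// indicE.
- by apply: prode_ge0 => i _; exact: measure_ge0.
Qed.

Lemma integral_gaussian_density n :
  (\int[lebesgue_rV R n]_x (gaussian_density x)%:E = 1)%E.
Proof.
have := @integral_gaussian_box n (fun=> setT) (fun=> measurableT).
rewrite [box _](_ : _ = setT)//; last by apply/seteqP; split.
by move=> ->; rewrite big1// => i _; exact: probability_setT.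
Qed.

End gaussian_rV.

(** * Invariance of Lebesgue and Gaussian measure under linear isometries *)

Section isometry.
Variables (R : realType) (n : nat).
Implicit Types (x y : 'rV[R]_n) (F : 'rV[R]_n -> \bar R).

Let g x : \bar R := (gaussian_density x)%:E.

Let g0 x : (0 <= g x)%E.
Proof. by rewrite lee_fin gaussian_density_ge0. Qed.

Let mg : measurable_fun setT g.
Proof. by apply/measurable_EFinP; exact: measurable_gaussian_density. Qed.

Lemma measurable_rV_add dT (T : measurableType dT) (f h : T -> 'rV[R]_n) :
  measurable_fun setT f -> measurable_fun setT h ->
  measurable_fun setT (fun t => f t + h t).
Proof.
move=> mf mh; apply: measurable_fun_rV => i.
apply: (eq_measurable_fun (fun t => f t ord0 i + h t ord0 i)) => [t _|].
  by rewrite mxE.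
by apply: measurable_funD; apply: measurableT_comp (measurable_rV_coord i) _.
Qed.

Lemma measurable_rV_opp dT (T : measurableType dT) (f : T -> 'rV[R]_n) :
  measurable_fun setT f -> measurable_fun setT (fun t => - f t).
Proof.
move=> mf; apply: measurable_fun_rV => i.
apply: (eq_measurable_fun (fun t => - f t ord0 i)) => [t _|].
  by rewrite mxE.
by apply: measurableT_comp => //; apply: measurableT_comp (measurable_rV_coord i) _.
Qed.

(** A bijective additive isometry [phi] preserves Lebesgue measure.  The double
    integral of [F (phi x) * g (y - phi x)], with [g] the Gaussian density, is
    computed in both orders: integrating [y] first leaves the integral of
    [F \o phi]; integrating [x] first, after the translation of [x] by
    [psi y], it becomes that of [F (phi x + y) * g x], and then equals the
    integral of [F].  The isometry property is used through [g \o phi = g]. *)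
Lemma integral_lebesgue_rV_isometry (phi psi : 'rV[R]_n -> 'rV[R]_n) F :
  measurable_fun setT phi -> {morph phi : x y / x + y} -> cancel psi phi ->
  (forall x, enorm (phi x) = enorm x) ->
  measurable_fun setT F -> (forall x, 0 <= F x)%E ->
  (\int[lebesgue_rV R n]_x F (phi x) = \int[lebesgue_rV R n]_x F x)%E.
Proof.
move=> mphi phiD psiK phi_norm mF F0.
have gE x y : enorm x = enorm y -> g x = g y.
  by rewrite /g /gaussian_density => ->.
pose K1 (z : 'rV[R]_n * 'rV[R]_n) := (F (phi z.1) * g (z.2 - phi z.1)%R)%E.
pose K2 (z : 'rV[R]_n * 'rV[R]_n) := (F (phi z.1 + z.2)%R * g z.1)%E.
have mphi1 : measurable_fun setT (fun z : 'rV[R]_n * 'rV[R]_n => phi z.1).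
  exact: measurableT_comp.
have mK1 : measurable_fun setT K1.
  apply: emeasurable_funM; first exact: measurableT_comp.
  apply: measurableT_comp => //; apply: measurable_rV_add => //.
  exact: measurable_rV_opp.
have mK2 : measurable_fun setT K2.
  apply: emeasurable_funM; last exact: measurableT_comp.
  by apply: measurableT_comp => //; exact: measurable_rV_add.
have K10 z : (0 <= K1 z)%E by exact: mule_ge0.
have K20 z : (0 <= K2 z)%E by exact: mule_ge0.
transitivity (\int[lebesgue_rV R n]_x \int[lebesgue_rV R n]_y K1 (x, y))%E.
  apply: eq_integral => x _; rewrite /K1/= ge0_integralZl//; last first.
    by apply: measurableT_comp => //; exact: measurable_rV_shift.
  rewrite (integral_lebesgue_rV_shift (- phi x) mg)//.
  by rewrite integral_gaussian_density mule1.
rewrite (fubini_tonelli K1 mK1 K10).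
transitivity (\int[lebesgue_rV R n]_y \int[lebesgue_rV R n]_x K2 (x, y))%E.
  apply: eq_integral => y _.
  have mK1y : measurable_fun setT (fun x => K1 (x, y)).
    by apply: measurableT_comp mK1 _; exact: measurable_pair2.
  rewrite -(integral_lebesgue_rV_shift (psi y) mK1y (fun x => K10 _)).
  apply: eq_integral => x _; rewrite /K1/K2/= phiD psiK; congr (_ * _)%E.
  by apply: gE; rewrite opprD addrCA subrr addr0 enormN.
rewrite -(fubini_tonelli K2 mK2 K20).
transitivity (\int[lebesgue_rV R n]_x ((\int[lebesgue_rV R n]_y F y) * g x))%E.
  apply: eq_integral => x _; rewrite -(integral_lebesgue_rV_shift (phi x) mF)//.
  rewrite -ge0_integralZr//; last first.
    by apply: measurableT_comp => //; exact: measurable_rV_shift.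
  by apply: eq_integral => y _; rewrite /K2/= addrC.
rewrite ge0_integralZl//; last exact: integral_ge0.
by rewrite integral_gaussian_density mule1.
Qed.

Lemma integral_gaussian_isometry (phi psi : 'rV[R]_n -> 'rV[R]_n) (A : set 'rV[R]_n) :
  measurable_fun setT phi -> {morph phi : x y / x + y} -> cancel psi phi ->
  (forall x, enorm (phi x) = enorm x) -> measurable A ->
  (\int[lebesgue_rV R n]_(x in phi @^-1` A) (gaussian_density x)%:E =
   \int[lebesgue_rV R n]_(x in A) (gaussian_density x)%:E)%E.
Proof.
move=> mphi phiD psiK phi_norm mA.
rewrite integral_mkcond [RHS]integral_mkcond.
rewrite -[RHS](integral_lebesgue_rV_isometry mphi phiD psiK phi_norm).
- apply: eq_integral => x _; rewrite !patchE /gaussian_density phi_norm.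
  by rewrite (_ : (x \in phi @^-1` A) = (phi x \in A))// !inE.
- exact/(measurable_restrictT _ _).1/measurable_funTS.
- by move=> x; apply: erestrict_ge0 => y _; exact: g0.
Qed.

End isometry.

(** * The joint law of independent standard Gaussian vectors *)

Section gaussian_prob.
Variables (R : realType) (n : nat).

(** The standard Gaussian measure of R^n. *)
Definition gaussian_prob (A : set 'rV[R]_n) : \bar R :=
  (\int[lebesgue_rV R n]_(x in A) (gaussian_density x)%:E)%E.

Let gaussian_prob0 : gaussian_prob set0 = 0%E.
Proof. by rewrite /gaussian_prob integral_set0. Qed.

Let gaussian_prob_ge0 A : (0 <= gaussian_prob A)%E.
Proof. by apply: integral_ge0 => x _; rewrite lee_fin gaussian_density_ge0. Qed.

Let gaussian_prob_sigma_additive : semi_sigma_additive gaussian_prob.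
Proof.
move=> A mA tA mUA; rewrite /gaussian_prob ge0_integral_bigcup//.
- by apply: is_cvg_ereal_nneg_natsum_cond => k _ _; exact: gaussian_prob_ge0.
- apply/measurable_funTS/measurable_EFinP; exact: measurable_gaussian_density.
- by move=> x _; rewrite lee_fin gaussian_density_ge0.
Qed.

HB.instance Definition _ := isMeasure.Build _ _ _ gaussian_prob
  gaussian_prob0 gaussian_prob_ge0 gaussian_prob_sigma_additive.

Let gaussian_probT : gaussian_prob setT = 1%E.
Proof. exact: integral_gaussian_density. Qed.

HB.instance Definition _ :=
  @Measure_isProbability.Build _ _ R gaussian_prob gaussian_probT.

End gaussian_prob.

Section joint_law.
Variable R : realType.

(** Boxes generate the Borel sets, so they determine a probability measure. *)
Lemma eq_probability_rV n (mu nu : probability 'rV[R]_n R) :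
  (forall B : 'I_n -> set R, (forall i, measurable (B i)) ->
     mu (box B) = nu (box B)) ->
  forall A, measurable A -> mu A = nu A.
Proof.
move=> munu A mA.
pose G : set (set 'rV[R]_n) :=
  [set C | exists2 B : 'I_n -> set R, forall i, measurable (B i) & C = box B].
apply: (g_sigma_algebra_measure_unique G _ (fun=> setT)).
- by move=> _ [B mB ->]; exact: measurable_box.
- by move=> _; exists (fun=> setT) => //; apply/seteqP; split.
- by apply/seteqP; split => // x _; exists 0%N.
- move=> _ _ [B mB ->] [C mC ->]; exists (fun i => B i `&` C i).
    by move=> i; exact: measurableI.
  apply/seteqP; split => x /=; first by move=> [hB hC] i; split.
  by move=> h; split=> i; have [] := h i.
- by move=> _ [B mB ->]; exact: munu.
- by move=> _; exact: le_lt_trans (probability_le1 _ _) (ltry _).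
suff : (@measurable _ 'rV[R]_n) `<=` <<s G >> by exact.
apply: sub_sigma_algebra2; rewrite -bigcup_seq => C [i _] [B mB <-].
exists (fun j => if j == i then B else setT) => [j|]; first by case: ifP.
apply/seteqP; split => x /=.
  by move=> [_ Bx] j; case: ifP => // /eqP ->.
by move=> /(_ i); rewrite eqxx.
Qed.

Variables (dT : measure_display) (T : measurableType dT) (P : probability T R).
Variables (m d : nat) (X : 'I_m -> {RV P >-> 'rV[R]_d}).

(** The vectors [X i] listed one after the other in a single row. *)
Definition joint_row (w : T) : 'rV[R]_(m * d) := mxvec (\matrix_i X i w).

Lemma joint_rowE w i j : joint_row w ord0 (mxvec_index i j) = X i w ord0 j.
Proof. by rewrite mxvecE mxE. Qed.

Lemma measurable_joint_row : measurable_fun setT joint_row.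
Proof.
apply: measurable_fun_rV => k; case/mxvec_indexP: k => i j.
apply: (eq_measurable_fun (fun w => X i w ord0 j)) => [w _|].
  by rewrite joint_rowE.
by apply: measurableT_comp (measurable_rV_coord j) _.
Qed.

Lemma joint_row_law : independent X -> (forall i, standard_gaussian (X i)) ->
  forall A, measurable A -> P (joint_row @^-1` A) = gaussian_prob A.
Proof.
move=> indX gaussX A mA.
pose Jm := isMeasurableFun.Build _ _ _ _ _ measurable_joint_row.
pose J : {RV P >-> 'rV[R]_(m * d)} := HB.pack joint_row Jm.
apply: (@eq_probability_rV _ (distribution P J) (@gaussian_prob R (m * d))) mA.
move=> B mB.
rewrite [RHS]integral_gaussian_box// [LHS](_ : _ =
    P (\bigcap_(i in [set` [set: 'I_m]%SET])
      X i @^-1` box (fun j => B (mxvec_index i j)))); last first.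
  congr (P _); apply/seteqP; split => w /= h.
    by move=> i _ j /=; rewrite -joint_rowE.
  by move=> k; case/mxvec_indexP: k => i j; rewrite joint_rowE; apply: h; rewrite /= inE.
rewrite indX; last by move=> i; exact: measurable_box.
under eq_bigr => i _.
  rewrite [P _](gaussX i); last exact: measurable_box.
  rewrite integral_gaussian_box//.
  over.
rewrite pair_big/= (reindex _ (curry_mxvec_bij m d))/=.
by apply: eq_big => [[i j]|[i j] _]; rewrite ?inE.
Qed.

End joint_law.

(** * Matrices depending measurably on a parameter *)

Section measurable_mx.
Variables (R : realType) (dT : measure_display) (T : measurableType dT).

(** Measurability of a matrix-valued function, entry by entry. *)
Definition measurable_mx m n (A : T -> 'M[R]_(m, n)) : Prop :=
  forall i j, measurable_fun setT (fun t => A t i j).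

Lemma measurable_mx_cst m n (A : 'M[R]_(m, n)) : measurable_mx (fun=> A).
Proof. by move=> i j; exact: measurable_cst. Qed.

Lemma measurable_mulmx m n p (A : T -> 'M[R]_(m, n)) (B : T -> 'M[R]_(n, p)) :
  measurable_mx A -> measurable_mx B -> measurable_mx (fun t => A t *m B t).
Proof.
move=> mA mB i j.
apply: (eq_measurable_fun (fun t => \sum_k A t i k * B t k j)) => [t _|].
  by rewrite mxE.
by apply: measurable_sum => k; exact: measurable_funM.
Qed.

Lemma measurable_scalemx m n (a : T -> R) (A : T -> 'M[R]_(m, n)) :
  measurable_fun setT a -> measurable_mx A -> measurable_mx (fun t => a t *: A t).
Proof.
move=> ma mA i j.
apply: (eq_measurable_fun (fun t => a t * A t i j)) => [t _|].
  by rewrite mxE.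
exact: measurable_funM.
Qed.

Lemma measurable_det n (A : T -> 'M[R]_n) :
  measurable_mx A -> measurable_fun setT (fun t => \det (A t)).
Proof.
move=> mA; apply: measurable_sum => s; apply: measurable_funM => //.
by apply: measurable_prod => i _; exact: mA.
Qed.

Lemma measurable_adj n (A : T -> 'M[R]_n) :
  measurable_mx A -> measurable_mx (fun t => \adj (A t)).
Proof.
move=> mA i j; apply: (eq_measurable_fun
  (fun t => (-1) ^+ (j + i) * \det (row' j (col' i (A t))))) => [t _|].
  by rewrite mxE.
apply: measurable_funM => //; apply: measurable_det => k l.
apply: (eq_measurable_fun (fun t => A t (lift j k) (lift i l))) => [t _|//].
by rewrite !mxE.
Qed.

Lemma measurable_vec_mx m n (v : T -> 'rV[R]_(m * n)) :
  measurable_fun setT v -> measurable_mx (fun t => vec_mx (v t) : 'M[R]_(m, n)).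
Proof.
move=> mv i j.
apply: (eq_measurable_fun (fun t => v t ord0 (mxvec_index i j))) => [t _|].
  by rewrite mxE.
by apply: measurableT_comp (measurable_rV_coord _) _.
Qed.

Lemma measurable_mxvec m n (A : T -> 'M[R]_(m, n)) :
  measurable_mx A -> measurable_fun setT (fun t => mxvec (A t)).
Proof.
move=> mA; apply: measurable_fun_rV => k; case/mxvec_indexP: k => i j.
by apply: (eq_measurable_fun (fun t => A t i j)) => [t _|//]; rewrite mxvecE.
Qed.

Lemma measurable_mx_rV n (v : T -> 'rV[R]_n) :
  measurable_fun setT v -> measurable_mx v.
Proof.
move=> mv i j; rewrite (ord1 i).
by apply: measurableT_comp (measurable_rV_coord _) _.
Qed.

End measurable_mx.

(** * A Gaussian matrix is almost surely invertible *)

Section gaussian_null.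
Variable R : realType.

(** A set that every parallel to a fixed direction [a] meets in finitely many
    points is negligible: by Tonelli's theorem and invariance under translations,
    the integral over [t] of the Lebesgue measure of [S - t *: a], which does not
    depend on [t], is the integral over [x] of the length of a finite set. *)
Lemma gaussian_prob_null_lines n (a : 'rV[R]_n) (S : set 'rV[R]_n) :
  measurable S -> (forall x, finite_set [set t : R | S (x + t *: a)]) ->
  gaussian_prob S = 0%E.
Proof.
move=> mS finS.
suff S0 : lebesgue_rV R n S = 0%E.
  apply: null_set_integral => //; apply: measurable_funTS.
  by apply/measurable_EFinP; exact: measurable_gaussian_density.
pose K (z : R * 'rV[R]_n) : \bar R := (\1_S (z.2 + z.1 *: a)%R)%:E.
have m1S : measurable_fun setT (fun x : 'rV[R]_n => (\1_S x)%:E : \bar R).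
  by apply/measurable_EFinP; exact: measurable_indic.
have mK : measurable_fun setT K.
  apply: measurableT_comp m1S _; apply: measurable_rV_add => //.
  apply: measurable_fun_rV => i.
  apply: (eq_measurable_fun (fun z : R * 'rV[R]_n => z.1 * a ord0 i)) => [z _|].
    by rewrite mxE.
  by apply: measurable_funM.
have K0 z : (0 <= K z)%E by rewrite lee_fin.
have := fubini_tonelli (m1 := @lebesgue_measure R) (m2 := lebesgue_rV R n) K mK K0.
rewrite [RHS]integral0_eq; last first.
  move=> x _; rewrite (eq_integral (fun t : measurableTypeR R =>
      (\1_[set t : R | S (x + t *: a)] t)%:E)).
    rewrite integral_indic//; last first.
      exact/countable_measurable/finite_set_countable.
    by rewrite setIT; exact/countable_lebesgue_measure0/finite_set_countable.
  by move=> t _; rewrite /K/= !indicE; congr (_%:R%:E); apply/idP/idP; rewrite !inE.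
under eq_integral => t _.
  rewrite /K (integral_lebesgue_rV_shift (t *: a) m1S)//.
  rewrite integral_indic// setIT.
  over.
rewrite integral_cst// => /eqP; rewrite mule_eq0 => /orP[/eqP//|].
have := @lebesgue_measure_itv R `]-oo, +oo[; rewrite set_itvNyy/= => muT.
by move=> /eqP; rewrite [LHS]muT.
Qed.

Lemma finite_set_roots (p : {poly R}) : p != 0 -> finite_set [set t | root p t].
Proof.
have [n] := ubnP (size p); elim: n => // n IH in p * => /ltnSE szp p0.
have [[a pa]|noroot] := pselect (exists a, root p a); last first.
  rewrite (_ : [set t | _] = set0) //.
  by apply/seteqP; split => // t pt; apply: noroot; exists t.
have /factor_theorem[q pE] := pa.
have q0 : q != 0 by apply: contra_neq p0 => q0; rewrite pE q0 mul0r.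
have szq : (size q < n)%N.
  by apply: leq_trans szp; rewrite pE size_Mmonic ?monicXsubC// size_XsubC addn2.
apply: (@sub_finite_set _ _ ([set t | root q t] `|` [set a])).
  by move=> t /=; rewrite pE rootM root_XsubC => /orP[|/eqP]; [left|right].
by rewrite finite_setU; split; [exact: IH|exact: finite_set1].
Qed.

(** These [t] are roots of the characteristic polynomial of [- A]. *)
Lemma finite_set_det0 n (A : 'M[R]_n) :
  finite_set [set t : R | \det (A + t%:M) = 0].
Proof.
apply: sub_finite_set (@finite_set_roots (char_poly (- A)) _); last first.
  by rewrite monic_neq0// char_poly_monic.
move=> t /= det0; rewrite -eigenvalue_root_char /eigenvalue /eigenspace.
rewrite kermx_eq0 row_free_unit unitmxE unitfE -opprD.
by rewrite -scaleN1r detZ det0 mulr0 eqxx.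
Qed.

(** Along the direction [E], the square matrix [D *m vec_mx x] is translated by
    the scalar matrices. *)
Lemma gaussian_prob_det0 m d (D : 'M[R]_(d, m)) (E : 'M[R]_(m, d)) :
  D *m E = 1%:M ->
  gaussian_prob [set x : 'rV[R]_(m * d) | \det (D *m vec_mx x) = 0] = 0%E.
Proof.
move=> DE; apply: (@gaussian_prob_null_lines _ (mxvec E)).
  rewrite [X in measurable X](_ : _ = setT `&`
    (fun x : 'rV[R]_(m * d) => \det (D *m vec_mx x)) @^-1` [set 0]); last first.
    by rewrite setTI.
  apply: measurable_det => //; apply: measurable_mulmx.
    exact: measurable_mx_cst.
  exact: measurable_vec_mx.
move=> x; apply: sub_finite_set (finite_set_det0 (D *m vec_mx x)) => t /=.
by rewrite linearD linearZ/= mxvecK mulmxDr -scalemxAr DE scalemx1.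
Qed.

End gaussian_null.

(** * Orthogonal matrices act transitively on the unit sphere of a subspace *)

Section geometry.
Variables (R : realType) (n : nat).
Implicit Types (x y : 'rV[R]_n) (U : set 'rV[R]_n) (Q : 'M[R]_n).

Lemma enorm_ge0 x : 0 <= enorm x.
Proof. exact: sqrtr_ge0. Qed.

Lemma mulmx_trE x y : x *m y^T = (\sum_i x ord0 i * y ord0 i)%:M.
Proof.
rewrite [LHS]mx11_scalar !mxE; congr _%:M.
by apply: eq_bigr => i _; rewrite mxE.
Qed.

Lemma enorm_sqr_mx x : x *m x^T = (enorm x ^+ 2)%:M.
Proof. by rewrite mulmx_trE enormE; congr _%:M; apply: eq_bigr. Qed.

Lemma enorm_orthogonal x Q : Q *m Q^T = 1%:M -> enorm (x *m Q) = enorm x.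
Proof.
move=> QQ; apply/eqP; rewrite -(eqrXn2 (n := 2)) ?enorm_ge0//.
have := enorm_sqr_mx (x *m Q).
rewrite trmx_mul mulmxA -(mulmxA x) QQ mulmx1 enorm_sqr_mx.
by move/matrixP/(_ ord0 ord0); rewrite !mxE eqxx !mulr1n => ->.
Qed.

Lemma enorm_eq0 x : (enorm x == 0) = (x == 0).
Proof.
apply/eqP/eqP => [x0|->]; last first.
  apply/eqP; rewrite /enorm big1 ?sqrtr0// => i _.
  by rewrite mxE expr0n.
apply/rowP => i; rewrite mxE; apply/eqP; rewrite -sqrf_eq0.
have : \sum_i x ord0 i ^+ 2 = 0 by rewrite -enormE x0 expr0n.
move/eqP; rewrite psumr_eq0 => [/allP/(_ i)|j _]; rewrite ?sqr_ge0//.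
by rewrite mem_index_enum => /(_ isT).
Qed.

Lemma enormZ (a : R) x : enorm (a *: x) = `|a| * enorm x.
Proof.
rewrite /enorm -sqrtr_sqr -sqrtrM ?sqr_ge0//; congr Num.sqrt.
by rewrite mulr_sumr; apply: eq_bigr => i _; rewrite mxE exprMn.
Qed.

Lemma linear_subspace_lin U (a b : R) x y :
  linear_subspace U -> U x -> U y -> U (a *: x + b *: y).
Proof.
move=> [U0 UL] Ux Uy; apply: (UL) => //; rewrite -[_ *: y]addr0.
exact: UL.
Qed.

(** The matrix [Q] is that of the reflection along [x - y], which exchanges [x]
    and [y] and maps [U] into itself since [x - y] lies in [U]. *)
Lemma sphere_transitive U x y : linear_subspace U ->
  unit_sphere U x -> unit_sphere U y ->
  exists2 Q, Q *m Q^T = 1%:M /\ (forall z, U z -> U (z *m Q)) & x *m Q = y.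
Proof.
move=> linU [Ux x1] [Uy y1]; have [<-|xy] := eqVneq x y.
  exists 1%:M; rewrite ?mulmx1// trmx1 mulmx1.
  by split => // z; rewrite mulmx1.
pose w := x - y; pose c := enorm w ^+ 2.
have c0 : c != 0 by rewrite expf_eq0/= enorm_eq0 subr_eq0.
have Uw : U w.
  have := linear_subspace_lin 1 (-1) linU Ux Uy.
  by rewrite scale1r scaleN1r.
have ww : w *m w^T = c%:M by exact: enorm_sqr_mx.
pose Q := 1%:M - (2 / c) *: (w^T *m w).
have QT : Q^T = Q.
  by rewrite linearB/= trmx1 linearZ/= trmx_mul trmxK.
exists Q; first split.
- have WW : (w^T *m w) *m (w^T *m w) = c *: (w^T *m w).
    by rewrite -mulmxA (mulmxA w) ww mul_scalar_mx -scalemxAr.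
  rewrite QT /Q mulmxBr mulmx1 mulmxBl mul1mx -scalemxAr -scalemxAl WW.
  rewrite !scalerA (_ : 2 / c * _ * c = 2 / c + 2 / c); last by field.
  rewrite scalerDl; set a := _ *: _.
  have -> : a - (a + a) = - a by rewrite opprD addrA subrr sub0r.
  by rewrite opprK subrK.
- move=> z Uz; rewrite mulmxBr mulmx1 -scalemxAr mulmxA mulmx_trE mul_scalar_mx.
  rewrite scalerA -scaleNr -[z in X in X + _]scale1r.
  exact: linear_subspace_lin.
- have xw : x *m w^T = (c / 2)%:M.
    have xyE : x *m y^T = y *m x^T.
      by rewrite !mulmx_trE; congr _%:M; apply: eq_bigr => i _; rewrite mulrC.
    have : c%:M = 2 *: (x *m w^T).
      rewrite -ww !linearB/= !mulmxBl xyE !enorm_sqr_mx x1 y1.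
      by rewrite -scalerBr scaler_nat mulr2n opprB.
    move=> /(congr1 ( *:%R (2^-1))); rewrite scalerA mulVf ?pnatr_eq0// scale1r => <-.
    by rewrite scale_scalar_mx mulrC.
  rewrite mulmxBr mulmx1 -scalemxAr mulmxA xw mul_scalar_mx scalerA.
  rewrite (_ : 2 / c * (c / 2) = 1) ?scale1r; last by field.
  by rewrite opprB addrC subrK.
Qed.

End geometry.

(** * Slices of a measurable set of pairs *)

Section slices.
Variables (R : realType) (d1 d2 : measure_display).
Variables (T1 : measurableType d1) (T2 : measurableType d2).
Variables (mu : probability T1 R) (nu : probability T2 R).

(** Tonelli's theorem for the two ways of slicing a measurable set of pairs. *)
Lemma slice_swap (W : set (T1 * T2)) : measurable W ->
  (\int[mu]_x nu [set y | W (x, y)] = \int[nu]_y mu [set x | W (x, y)])%E.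
Proof.
move=> mW; have mf : measurable_fun setT (fun z => (\1_W z)%:E : \bar R).
  by apply/measurable_EFinP; exact: measurable_indic.
have f0 z : (0 <= (\1_W z)%:E :> \bar R)%E by rewrite lee_fin.
have := fubini_tonelli (m1 := mu) (m2 := nu) _ mf f0.
have mx x : measurable [set y | W (x, y)].
  by rewrite -[X in measurable X]setTI; exact: measurable_pair1.
have my y : measurable [set x | W (x, y)].
  by rewrite -[X in measurable X]setTI; exact: measurable_pair2.
have Lx x : (\int[nu]_y (\1_W (x, y))%:E = nu [set y | W (x, y)])%E.
  rewrite (eq_integral (fun y => (\1_[set y | W (x, y)] y)%:E)).
    by rewrite integral_indic// setIT.
  by move=> y _; rewrite !indicE; congr (_%:R%:E); apply/idP/idP; rewrite !inE.
have Ly y : (\int[mu]_x (\1_W (x, y))%:E = mu [set x | W (x, y)])%E.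
  rewrite (eq_integral (fun x => (\1_[set x | W (x, y)] x)%:E)).
    by rewrite integral_indic// setIT.
  by move=> x _; rewrite !indicE; congr (_%:R%:E); apply/idP/idP; rewrite !inE.
by under eq_integral do rewrite Lx; under [in RHS]eq_integral do rewrite Ly.
Qed.

Lemma measurable_slice (W : set (T1 * T2)) : measurable W ->
  measurable_fun setT (fun x => nu [set y | W (x, y)]).
Proof.
move=> mW; rewrite (_ : (fun x => _) = nu \o xsection W).
  exact: measurable_fun_xsection.
by apply/funext => x /=; congr (nu _); apply/seteqP; split => y; rewrite /xsection/= inE.
Qed.

End slices.

(** * Uniqueness of the uniform distribution on a sphere *)

Section uniform_unique.
Variables (R : realType) (n : nat) (U : set 'rV[R]_n).
Hypotheses (linU : linear_subspace U) (mS : measurable (unit_sphere U)).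
Implicit Types (x y : 'rV[R]_n) (mu nu : probability 'rV[R]_n R).

Let S := unit_sphere U.

(** The open Euclidean ball. *)
Let B x (r : R) : set 'rV[R]_n := [set y | enorm (x - y) < r].

Let measurable_dist : measurable_fun setT
  (fun z : 'rV[R]_n * 'rV[R]_n => enorm (z.1 - z.2)).
Proof.
apply: measurableT_comp; first exact: measurable_enorm.
by apply: measurable_rV_add => //; exact: measurable_rV_opp.
Qed.

(** The pairs of points of [A] at distance less than [r]. *)
Let near_pair (A : set 'rV[R]_n) (r : R) : set ('rV[R]_n * 'rV[R]_n) :=
  [set z | A z.1 /\ A z.2 /\ enorm (z.1 - z.2) < r].

Let measurable_near_pair A r : measurable A -> measurable (near_pair A r).
Proof.
move=> mA; rewrite (_ : near_pair A r = (fst @^-1` A) `&` ((snd @^-1` A) `&`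
    ((fun z : 'rV[R]_n * 'rV[R]_n => enorm (z.1 - z.2)) @^-1` [set t | t < r]))) //.
apply: measurableI; last apply: measurableI.
- by rewrite -[X in measurable X]setTI; exact: measurable_fst.
- by rewrite -[X in measurable X]setTI; exact: measurable_snd.
- rewrite -[X in measurable X]setTI; apply: measurable_dist => //.
  by rewrite -set_itvNyo; exact: measurable_itv.
Qed.

Let measurable_ball x r : measurable (B x r).
Proof.
have -> : B x r = xsection (near_pair setT r) x.
  by apply/seteqP; split => y; rewrite /xsection/= inE; [|case=> _ []].
by apply: measurable_xsection; exact: measurable_near_pair.
Qed.

Let uniform_ball mu x y r : uniform_on_unit_sphere U mu -> S x -> S y ->
  mu (B x r) = mu (B y r).
Proof.
move=> [_ mu_inv] Sx Sy; have [Q [QQ UQ] xQ] := sphere_transitive linU Sx Sy.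
rewrite -(mu_inv Q QQ UQ _ (measurable_ball y r)); congr (mu _).
by apply/seteqP; split => z; rewrite /B/= -xQ -mulmxBl enorm_orthogonal.
Qed.

(** Only countably many cubes of a fixed small size are needed to cover the
    sphere, and each of them lies in a ball centred on the sphere. *)
Let uniform_ball_gt0 mu x r : uniform_on_unit_sphere U mu -> S x -> 0 < r ->
  (0 < mu (B x r))%E.
Proof.
move=> mu_unif Sx r0; rewrite lt0e measure_ge0 andbT; apply/eqP => Bx0.
have B0 y : S y -> mu (B y r) = 0%E.
  by move=> Sy; rewrite (uniform_ball r mu_unif Sy Sx).
pose e := r / (2 * n.+1%:R).
have e0 : 0 < e by rewrite divr_gt0 ?mulr_gt0.
pose C (q : 'rV[rat]_n) : set 'rV[R]_n :=
  box (fun i => `](ratr (q ord0 i) - e), (ratr (q ord0 i) + e)[%classic).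
have mC q : measurable (C q) by apply: measurable_box => i; exact: measurable_itv.
have C0 q : mu.-negligible (S `&` C q).
  have [[y [Sy Cy]]|noy] := pselect (exists y, S y /\ C q y); last first.
    rewrite (_ : _ `&` _ = set0); first exact: negligible_set0.
    by apply/seteqP; split => // y [Sy Cy]; apply: noy; exists y.
  exists (B y r); split; [exact: measurable_ball|exact: B0|] => z [_ Cz].
  rewrite /B/= -(ltr_pXn2r (n := 2)) ?nnegrE ?enorm_ge0 ?(ltW r0)//.
  rewrite enormE (@le_lt_trans _ _ (\sum_(i < n) (2 * e) ^+ 2))//.
    apply: ler_sum => i _; rewrite !mxE.
    move: (Cy i) (Cz i); rewrite /= !in_itv/= => /andP[y1 y2] /andP[z1 z2].
    rewrite -ler_sqrt ?sqr_ge0// !sqrtr_sqr.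
    by rewrite (ger0_norm (ltW (mulr_gt0 _ e0)))// ler_norml; lra.
  rewrite sumr_const card_ord -[ltLHS]mulr_natl.
  have -> : 2 * e = r / n.+1%:R.
    by rewrite /e; field; rewrite nat1r pnatr_eq0.
  rewrite expr_div_n mulrA ltr_pdivrMr ?exprn_gt0// mulrC.
  rewrite ltr_pM2l ?exprn_gt0// -natrX ltr_nat.
  by rewrite -mulnn (leq_trans (ltnSn n))// leq_pmulr.
have : mu.-negligible (\bigcup_k (if unpickle k is Some q then S `&` C q else set0)).
  apply: negligible_bigcup => k; case: unpickle => [q|]; first exact: C0.
  exact: negligible_set0.
move=> [N [mN N0 subN]].
have : (mu S <= mu N)%E.
  apply: le_measure; rewrite ?inE// => y Sy; apply: subN.
  have qP i : exists q : rat, ratr q \in `]y ord0 i - e, y ord0 i + e[.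
    by apply: rat_in_itvoo; lra.
  pose q : 'rV[rat]_n := \row_i xchoose (qP i).
  exists (pickle q) => //; rewrite pickleK; split => // i.
  rewrite mxE /= in_itv/=.
  have := xchooseP (qP i); rewrite in_itv/= => /andP[h1 h2].
  by apply/andP; split; lra.
by rewrite mu_unif.1 N0 lee_fin ler10.
Qed.

Let uniform_sphereI mu A : uniform_on_unit_sphere U mu -> measurable A ->
  mu (S `&` A) = mu A.
Proof.
move=> [S1 _] mA; have SC0 : mu (~` S) = 0%E.
  by rewrite probability_setC// S1 subee.
rewrite -[in RHS](setIT A) -(setUv S) setIUr setIC measureU0//.
- exact: measurableI.
- by apply: measurableI => //; exact: measurableC.
- apply: (subset_measure0 _ _ _ SC0) => //; last exact: measurableC.
  by apply: measurableI => //; exact: measurableC.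
Qed.

Let near_pairC A r y : [set x | near_pair A r (x, y)] = [set x | near_pair A r (y, x)].
Proof.
by apply/seteqP; split => x [Ax [Ay xy]]; split=> //; split => //;
  rewrite /= -enormN opprB.
Qed.

(** All the balls of radius [r] centred on the sphere have the same mass, which
    moreover is the same for two uniform distributions. *)
Let uniform_ball_eq mu nu x y r : uniform_on_unit_sphere U mu ->
  uniform_on_unit_sphere U nu -> S x -> S y -> mu (B x r) = nu (B y r).
Proof.
move=> mu_unif nu_unif Sx Sy.
have half m1 m2 z : uniform_on_unit_sphere U m1 -> uniform_on_unit_sphere U m2 ->
    S z -> (\int[m1]_x m2 [set y | near_pair S r (x, y)] = m2 (B z r))%E.
  move=> u1 u2 Sz.
  rewrite (eq_integral (fun x => m2 (B z r) * (\1_S x)%:E)%E).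
    rewrite ge0_integralZl//; last by apply/measurable_EFinP; exact: measurable_indic.
    rewrite integral_indic// setIT -[RHS]mule1; congr (_ * _)%E; exact: u1.1.
  move=> a _; rewrite indicE; case: (boolP (a \in S)) => [/set_mem Sa|Sa].
    rewrite mule1 -(uniform_ball r u2 Sa Sz) -[RHS](uniform_sphereI u2)//.
    congr (m2 _); apply/seteqP; split => b; first by case=> _ [Sb ab]; split.
    by case=> Sb ab; split => //; split.
  rewrite mule0 (_ : [set y | _] = set0) ?measure0//.
  by apply/seteqP; split => // b [/= Sa' _]; move/negP: Sa; apply; exact/mem_set.
have := slice_swap mu nu (measurable_near_pair r mS).
under [in RHS]eq_integral do rewrite near_pairC.
by rewrite (half _ _ y)// (half _ _ x).
Qed.

(** Two uniform distributions [mu] and [nu] agree on relatively open sets [O]: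
    if [h k] denotes the common mass of the balls of radius [1 / (k + 1)], the
    quotient [nu (O `&` B x (1 / (k + 1))) / h k] tends to 1 at every [x] in
    [O], whereas by Tonelli its integral against [mu] over [O] is at most
    [nu O].  Fatou's lemma yields [mu O <= nu O]. *)
Let uniform_le mu nu (O : set 'rV[R]_n) : uniform_on_unit_sphere U mu ->
  uniform_on_unit_sphere U nu -> measurable O ->
  (forall x, S x -> O x -> exists2 r, 0 < r &
     forall y, S y -> enorm (x - y) < r -> O y) ->
  (mu O <= nu O)%E.
Proof.
move=> mu_unif nu_unif mO openO.
have [x0 Sx0] : exists x, S x.
  apply: contrapT => noS; have : mu S = 0%E.
    rewrite (_ : S = set0) ?measure0//; apply/seteqP; split => // x Sx.
    by apply: noS; exists x.
  by rewrite mu_unif.1 => /eqP; rewrite onee_eq0.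
pose A := S `&` O; have mA : measurable A by exact: measurableI.
pose r k : R := k.+1%:R^-1; pose h k := fine (nu (B x0 (r k))).
have hE k : nu (B x0 (r k)) = (h k)%:E by rewrite fineK// fin_num_measure.
have h0 k : 0 < h k.
  by rewrite -lte_fin -hE uniform_ball_gt0// invr_gt0.
pose f k x : \bar R := ((h k)^-1%:E * nu [set y | near_pair A (r k) (x, y)])%E.
have f0 k x : (0 <= f k x)%E by rewrite mule_ge0// lee_fin invr_ge0 ltW.
have mf k : measurable_fun setT (f k).
  by apply: measurable_funeM; apply: measurable_slice; exact: measurable_near_pair.
have flim x : limn_einf (f ^~ x) = (\1_A x)%:E.
  have fx : f k x @[k --> \oo] --> ((\1_A x)%:E : \bar R).
    apply: cvg_near_cst; rewrite indicE; case: (boolP (x \in A)) => [/set_mem[Sx Ox]|xA].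
      have [s s0 sO] := openO _ Sx Ox.
      have : \forall k \near \oo, r k < s by exact: near_infty_natSinv_lt (PosNum s0).
      apply: filterS => k rs; rewrite /f.
      rewrite [X in nu X](_ : _ = S `&` B x (r k)).
        rewrite (uniform_sphereI nu_unif)// (uniform_ball _ nu_unif Sx Sx0) hE -EFinM.
        by rewrite mulVf ?gt_eqF.
      apply/seteqP; split => y; first by case=> _ [[Sy _]].
      case=> Sy xy; split; first by split.
      by split => //; split => //; apply: sO => //; exact: lt_trans rs.
    apply: nearW => k; rewrite /f (_ : [set y | _] = set0) ?measure0 ?mule0//.
    by apply/seteqP; split => // y [/= Ax _]; move/negP: xA; apply; exact/mem_set.
  by rewrite is_cvg_limn_einfE; [exact: cvg_lim|apply/cvg_ex; exists (\1_A x)%:E].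
have := fatou mu measurableT mf (fun k x _ => f0 k x).
under eq_integral do rewrite flim.
rewrite integral_indic// setIT => /le_trans muA_le.
rewrite -(uniform_sphereI mu_unif mO); apply: muA_le.
rewrite limn_einf_lim; apply: lime_le; first exact: is_cvg_einfs.
apply: nearW => k.
apply: (@le_trans _ _ (\int[mu]_x f k x)%E).
  by apply: ereal_inf_lbound; exists k => //=.
rewrite /f ge0_integralZl//; last 2 first.
- by apply: measurable_slice; exact: measurable_near_pair.
- by rewrite lee_fin invr_ge0 ltW.
rewrite slice_swap; last exact: measurable_near_pair.
rewrite lee_pdivrMl//.
apply: (@le_trans _ _ (\int[nu]_y ((h k)%:E * (\1_A y)%:E))%E).
  apply: ge0_le_integral => //.
  - under eq_fun do rewrite near_pairC.
    by apply: measurable_slice; exact: measurable_near_pair.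
  - by apply/measurable_funeM/measurable_EFinP; exact: measurable_indic.
  - move=> y _; rewrite indicE; case: (boolP (y \in A)) => [/set_mem[Sy Oy]|yA].
      rewrite mule1 -hE -(uniform_ball_eq (r k) mu_unif nu_unif Sy Sx0).
      apply: le_measure; rewrite ?inE//.
        under eq_set do rewrite /=.
        have := measurable_ysection y (measurable_near_pair (r k) mA).
        by rewrite /ysection; under eq_set do rewrite inE.
      by move=> x [_ [_ /=]]; rewrite -enormN opprB.
    rewrite mule0 (_ : [set x | _] = set0) ?measure0//.
    by apply/seteqP; split => // x [_ [/= Ay _]]; move/negP: yA; apply; exact/mem_set.
rewrite ge0_integralZl//.
- rewrite integral_indic// setIT lee_pmul//; first by rewrite lee_fin ltW.
  by apply: le_measure; rewrite ?inE// => x [].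
- by apply/measurable_EFinP; exact: measurable_indic.
- by rewrite lee_fin ltW.
Qed.

Lemma uniform_on_unit_sphere_unique mu nu (O : set 'rV[R]_n) :
  uniform_on_unit_sphere U mu -> uniform_on_unit_sphere U nu -> measurable O ->
  (forall x, S x -> O x -> exists2 r, 0 < r &
     forall y, S y -> enorm (x - y) < r -> O y) ->
  mu O = nu O.
Proof. by move=> *; apply/eqP; rewrite eq_le !uniform_le. Qed.

Lemma uniform_on_unit_sphereI mu A : uniform_on_unit_sphere U mu ->
  measurable A -> mu (S `&` A) = mu A.
Proof. exact: uniform_sphereI. Qed.

End uniform_unique.

(** * Normalised random vectors *)

Section normalize.
Variables (R : realType) (n : nat).
Implicit Types x : 'rV[R]_n.

(** The point of the unit sphere in the direction of [x]; 0 for [x = 0]. *)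
Definition normalize x : 'rV[R]_n := (enorm x)^-1 *: x.

Lemma normalizeZ (a : R) x : 0 < a -> normalize (a *: x) = normalize x.
Proof.
move=> a0; rewrite /normalize enormZ gtr0_norm// scalerA invfM.
by rewrite mulrAC mulVf ?gt_eqF// mul1r.
Qed.

Lemma enorm_normalize x : x != 0 -> enorm (normalize x) = 1.
Proof.
move=> x0; rewrite enormZ ger0_norm ?invr_ge0 ?enorm_ge0//.
by rewrite mulVf// enorm_eq0.
Qed.

Lemma normalize_orthogonal x (Q : 'M[R]_n) : Q *m Q^T = 1%:M ->
  normalize (x *m Q) = normalize x *m Q.
Proof. by move=> QQ; rewrite /normalize enorm_orthogonal// scalemxAl. Qed.

Lemma measurable_normalize : measurable_fun setT normalize.
Proof.
apply: measurable_fun_rV => i.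
apply: (eq_measurable_fun (fun x : 'rV[R]_n => enorm x `^ (-1) * x ord0 i)) => [x _|].
  by rewrite mxE powR_inv1// enorm_ge0.
apply: measurable_funM; last exact: measurable_rV_coord.
exact: (measurableT_comp (measurable_powR (-1)) (@measurable_enorm R n)).
Qed.

Lemma measurable_mulmx_rV m (Q : 'M[R]_(m, n)) :
  measurable_fun setT (fun x : 'rV[R]_m => x *m Q).
Proof.
apply: measurable_fun_rV => i.
have mx : measurable_mx (fun x : 'rV[R]_m => x) by exact: measurable_mx_rV.
exact: (measurable_mulmx mx (measurable_mx_cst (T := 'rV[R]_m) Q) ord0 i).
Qed.

(** If a random vector [c] of [U] is almost surely nonzero, and if every
    isometry of [U] can be undone, in the direction of [c], by a
    measure-preserving map, then the direction of [c] is uniform. *)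
Lemma uniform_normalize (dT : measure_display) (T : measurableType dT)
    (P : probability T R) (U : set 'rV[R]_n) (c : {RV P >-> 'rV[R]_n}) (N : set T) :
  linear_subspace U -> measurable (unit_sphere U) ->
  measurable N -> P N = 0%E -> (forall t, ~ N t -> U (c t) /\ c t != 0) ->
  (forall Q : 'M[R]_n, Q *m Q^T = 1%:M -> (forall x, U x -> U (x *m Q)) ->
    exists2 tau : T -> T,
      forall A, measurable A -> P (tau @^-1` A) = P A &
      forall t, normalize (c (tau t) *m Q) = normalize (c t)) ->
  exists2 mu : probability 'rV[R]_n R, uniform_on_unit_sphere U mu &
    forall A, measurable A -> mu A = P [set t | A (normalize (c t))].
Proof.
move=> linU mS mN PN cU inv.
have mc : measurable_fun setT (normalize \o c).
  by apply: measurableT_comp => //; exact: measurable_normalize.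
pose c'_mixin := isMeasurableFun.Build _ _ _ _ _ mc.
pose c' : {RV P >-> 'rV[R]_n} := HB.pack (normalize \o c) c'_mixin.
exists (distribution P c') => //; split.
  have mS' : measurable (c' @^-1` unit_sphere U).
    by rewrite -[X in measurable X]setTI; exact (mc measurableT _ mS).
  apply/eqP; rewrite eq_le probability_le1//=.
  have -> : 1%E = P (~` N) by rewrite probability_setC// PN sube0.
  apply: le_measure; rewrite ?inE//; first exact: measurableC.
  move=> t /cU[Uct ct0]; split; last exact: enorm_normalize.
  have := linear_subspace_lin (enorm (c t))^-1 0 linU Uct Uct.
  by rewrite scale0r addr0.
move=> Q QQ UQ A mA; have [tau tauP tauQ] := inv Q QQ UQ.
rewrite /distribution /pushforward/=.
have mE : measurable [set t | A (normalize (c t) *m Q)].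
  rewrite -[X in measurable X]setTI.
  apply: (measurableT_comp (measurable_mulmx_rV Q) mc) => //.
rewrite [LHS](_ : _ = P (tau @^-1` [set t | A (normalize (c t) *m Q)])).
  by congr (P _); apply/seteqP; split => t /=; rewrite -normalize_orthogonal// tauQ.
by rewrite tauP.
Qed.

Lemma uniform_sphereP (U : set 'rV[R]_n) (mu : probability 'rV[R]_n R) :
  uniform_on_unit_sphere U mu -> uniform_on_unit_sphere U (uniform_sphere U).
Proof. by move=> mu_unif; apply: (xgetPex _ (ex_intro _ mu mu_unif)). Qed.

End normalize.

(** * The uniform distribution on the unit sphere of R^d exists *)

Section uniform_full.
Variables (R : realType).

Lemma measurable_unit_sphere n (U : set 'rV[R]_n) :
  measurable U -> measurable (unit_sphere U).
Proof.
move=> mU; rewrite (_ : unit_sphere U = U `&` (@enorm R n @^-1` [set 1]))//.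
apply: measurableI => //; rewrite -[X in measurable X]setTI.
exact: (@measurable_enorm R n measurableT _ (measurable_set1 1)).
Qed.

Lemma gaussian_prob_isometry n (phi psi : 'rV[R]_n -> 'rV[R]_n) A :
  measurable_fun setT phi -> {morph phi : x y / x + y} -> cancel psi phi ->
  (forall x, enorm (phi x) = enorm x) -> measurable A ->
  gaussian_prob (phi @^-1` A) = gaussian_prob A.
Proof. exact: integral_gaussian_isometry. Qed.

Lemma measurable_rV_zero n : measurable [set 0 : 'rV[R]_n].
Proof.
rewrite (_ : [set 0] = box (fun=> [set 0])).
  by apply: measurable_box => i; exact: measurable_set1.
apply/seteqP; split => x /=; first by move=> -> i /=; rewrite mxE.
by move=> x0; apply/rowP => i; rewrite mxE; exact: x0.
Qed.

Lemma gaussian_prob_set0 n : (0 < n)%N -> gaussian_prob [set 0 : 'rV[R]_n] = 0%E.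
Proof.
case: n => // n _; apply: (@gaussian_prob_null_lines _ _ (const_mx 1)).
  exact: measurable_rV_zero.
move=> x; apply: (@sub_finite_set _ _ [set - x ord0 ord0]); last exact: finite_set1.
move=> t /= /rowP/(_ ord0); rewrite !mxE mulr1 addrC => /eqP.
by rewrite addr_eq0 => /eqP.
Qed.

Lemma uniform_on_unit_sphereT n : (0 < n)%N ->
  uniform_on_unit_sphere [set: 'rV[R]_n] (uniform_sphere [set: 'rV[R]_n]).
Proof.
move=> n0.
have mid : measurable_fun [set: 'rV[R]_n] (fun x => x) by [].
pose id_mixin := isMeasurableFun.Build _ _ _ _ _ mid.
pose c : {RV (@gaussian_prob R n) >-> 'rV[R]_n} := HB.pack (fun x => x) id_mixin.
have [||||||mu mu_unif _] := @uniform_normalize R n _ _ (@gaussian_prob R n)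
    [set: 'rV[R]_n] c [set 0]; last exact: uniform_sphereP mu_unif.
- by split.
- exact: measurable_unit_sphere.
- exact: measurable_rV_zero.
- exact: gaussian_prob_set0.
- by move=> x /= x0; split => //; apply/eqP.
- move=> Q QQ _; have QQ' := mulmx1C QQ; exists (fun x => x *m Q^T).
    move=> A mA; apply: (@gaussian_prob_isometry _ _ (fun x => x *m Q)) => //.
    + exact: measurable_mulmx_rV.
    + by move=> x y; rewrite mulmxDl.
    + by move=> x; rewrite -mulmxA QQ mulmx1.
    + by move=> x; rewrite enorm_orthogonal// trmxK.
  by move=> x /=; rewrite -mulmxA QQ' mulmx1.
Qed.

End uniform_full.

(** * The cone of the regular simplex at a vertex *)

Section regular_cone.
Variables (R : realType) (d : nat) (i : 'I_d.+1).

(** Left multiplication by [edge_mx] turns the matrix whose rows are the points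
    [x_0, ..., x_d] into that of the [d] edges [x_j - x_i], [j != i]; its own
    rows are the edges at the vertex [e_i] of the regular simplex. *)
Definition edge_mx : 'M[R]_(d, d.+1) :=
  \matrix_k (delta_mx ord0 (lift i k) - delta_mx ord0 i).

(** The projection that forgets the [i]th coordinate. *)
Definition drop_mx : 'M[R]_(d.+1, d) := \matrix_(j, k) (j == lift i k)%:R.

(** The hyperplane of the vectors whose coordinates sum to 0. *)
Definition sum0 : set 'rV[R]_d.+1 := [set x | \sum_j x ord0 j = 0].

Lemma mulmx_drop m (A : 'M[R]_(m, d.+1)) j k : (A *m drop_mx) j k = A j (lift i k).
Proof.
rewrite mxE (bigD1 (lift i k))//= mxE eqxx mulr1 big1 ?addr0// => l lk.
by rewrite mxE (negbTE lk) mulr0.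
Qed.

Lemma edge_drop_mx : edge_mx *m drop_mx = 1%:M.
Proof.
apply/matrixP => k l; rewrite mulmx_drop !mxE !eqxx/=.
rewrite (inj_eq lift_inj) eq_sym [lift i l == i]eq_sym.
by rewrite (negbTE (neq_lift _ _)) subr0 eq_sym.
Qed.

Lemma mulmx_edgeE m (x : 'M[R]_(d.+1, m)) k :
  row k (edge_mx *m x) = row (lift i k) x - row i x.
Proof. by rewrite row_mul rowK mulmxBl -!rowE. Qed.

Lemma sum0_edge (l : 'rV[R]_d) : sum0 (l *m edge_mx).
Proof.
rewrite /sum0/=.
have -> : \sum_j (l *m edge_mx) ord0 j = (l *m edge_mx *m const_mx 1) ord0 (ord0 : 'I_1).
  by rewrite [RHS]mxE; apply: eq_bigr => j _; rewrite [const_mx _ _ _]mxE mulr1.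
rewrite -mulmxA (_ : edge_mx *m _ = 0) ?mulmx0 ?mxE//.
apply/row_matrixP => k; rewrite mulmx_edgeE.
by apply/rowP => j; rewrite !mxE subrr.
Qed.

Lemma sum0_dropK (x : 'rV[R]_d.+1) : sum0 x -> x *m drop_mx *m edge_mx = x.
Proof.
move=> x0.
have xl k : (x *m drop_mx *m edge_mx) ord0 (lift i k) = x ord0 (lift i k).
  by rewrite -[LHS]mulmx_drop -[_ *m _ *m drop_mx]mulmxA edge_drop_mx mulmx1 mulmx_drop.
apply/rowP => j; case: (unliftP i j) => [k ->|->]; first exact: xl.
move: x0 (sum0_edge (x *m drop_mx)); rewrite /sum0/= !(bigD1_ord i)//=.
rewrite (eq_bigr _ (fun k _ => xl k)) => x_sum0 e_sum0.
by apply: addIr; exact: etrans e_sum0 (esym x_sum0).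
Qed.

Lemma linear_subspace_sum0 : linear_subspace sum0.
Proof.
split=> [|a x y]; rewrite /sum0/=; first by rewrite big1// => j _; rewrite mxE.
move=> x0 y0; transitivity (a * \sum_j x ord0 j + \sum_j y ord0 j).
  by rewrite mulr_sumr -big_split; apply: eq_bigr => j _; rewrite !mxE.
by rewrite x0 y0 mulr0 addr0.
Qed.

Lemma measurable_sum0 : measurable sum0.
Proof.
have mf : measurable_fun setT (fun x : 'rV[R]_d.+1 => \sum_j x ord0 j).
  by apply: measurable_sum => j; exact: measurable_rV_coord.
rewrite (_ : sum0 = setT `&` (fun x : 'rV[R]_d.+1 => \sum_j x ord0 j) @^-1` [set 0]).
  exact: mf measurableT _ (measurable_set1 0).
by rewrite setTI.
Qed.

(** The term of index [i], whose edge is 0, disappears. *)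
Lemma sum_edges n (M : 'M[R]_(d.+1, n)) (l : 'I_d.+1 -> R) :
  \sum_j l j *: (row j M - row i M) =
  (\row_k l (lift i k)) *m (edge_mx *m M).
Proof.
rewrite mulmx_sum_row (bigD1_ord i)//= subrr scaler0 add0r.
by apply: eq_bigr => k _; rewrite mulmx_edgeE mxE.
Qed.

Lemma pos_edges n (M : 'M[R]_(d.+1, n)) :
  pos (fun j => row j M - row i M) =
  [set y | exists2 a : 'rV[R]_d, forall k, 0 <= a ord0 k &
                                 y = a *m (edge_mx *m M)].
Proof.
apply/seteqP; split => y /= [l l0 ->].
  exists (\row_k l (lift i k)); last exact: sum_edges.
  by move=> k; rewrite mxE.
exists (fun j => if unlift i j is Some k then l ord0 k else 0).
  by move=> j; case: unlift.
rewrite sum_edges; congr (_ *m _); apply/rowP => k.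
by rewrite mxE liftK.
Qed.

Lemma lin_edges n (M : 'M[R]_(d.+1, n)) :
  lin (pos (fun j => row j M - row i M)) =
  [set y | exists a : 'rV[R]_d, y = a *m (edge_mx *m M)].
Proof.
apply/seteqP; split => y.
  apply; split; last by rewrite pos_edges => _ [a _ ->]; exists a.
  split; first by exists 0; rewrite mul0mx.
  move=> b _ _ [a1 ->] [a2 ->]; exists (b *: a1 + a2).
  by rewrite mulmxDl scalemxAl.
move=> [a ->] L [[L0 Llin] posL]; rewrite mulmx_sum_row.
elim/big_ind : _ => //.
  by move=> u v Lu Lv; rewrite -[u]scale1r; exact: Llin.
move=> k _; rewrite -[_ *: _]addr0; apply: Llin => //; apply: posL.
rewrite pos_edges; exists (delta_mx ord0 k); last by rewrite rowE.
by move=> l; rewrite mxE ler0n.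
Qed.

Lemma regular_coneE :
  pos (fun j => @regular_simplex R d j - @regular_simplex R d i) =
  [set y | sum0 y /\ forall k, 0 <= y ord0 (lift i k)].
Proof.
have -> : (fun j => @regular_simplex R d j - @regular_simplex R d i) =
    (fun j => row j 1%:M - row i 1%:M).
  by apply/funext => j; rewrite !row1.
rewrite pos_edges mulmx1; apply/seteqP; split => y /=.
  move=> [a a0 ->]; split; first exact: sum0_edge.
  by move=> k; rewrite -mulmx_drop -mulmxA edge_drop_mx mulmx1.
move=> [y0 yk]; exists (y *m drop_mx); last by rewrite sum0_dropK.
by move=> k; rewrite mulmx_drop.
Qed.

Lemma lin_regular_cone :
  lin (pos (fun j => @regular_simplex R d j - @regular_simplex R d i)) = sum0.
Proof.
have -> : (fun j => @regular_simplex R d j - @regular_simplex R d i) =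
    (fun j => row j 1%:M - row i 1%:M).
  by apply/funext => j; rewrite !row1.
rewrite lin_edges mulmx1; apply/seteqP; split => y /=.
  by move=> [a ->]; exact: sum0_edge.
by move=> y0; exists (y *m drop_mx); rewrite sum0_dropK.
Qed.

End regular_cone.

(** * The cone spanned by the edges of a Gaussian simplex *)

Section gaussian_cone.
Variables (R : realType) (d : nat) (i : 'I_d.+1).
Implicit Types (x : 'rV[R]_(d.+1 * d)) (z : 'rV[R]_d).

Let D : 'M[R]_(d, d.+1) := edge_mx R i.
Let E : 'M[R]_(d.+1, d) := drop_mx R i.
Let gamma := @gaussian_prob R (d.+1 * d).

(** The edges at the [i]th vertex of the simplex whose vertices are the rows
    of [vec_mx x]. *)
Definition edges x : 'M[R]_d := D *m vec_mx x.

(** A positive multiple of the coordinates of [z] in the basis [edges x]; 0 if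
    the edges are linearly dependent.  Unlike the coordinates, it is polynomial
    in [x]. *)
Definition edge_coord x z : 'rV[R]_d := z *m (\det (edges x) *: \adj (edges x)).

Lemma edge_coordE x z : \det (edges x) != 0 ->
  edge_coord x z = \det (edges x) ^+ 2 *: (z *m invmx (edges x)).
Proof.
move=> det0; rewrite /edge_coord /invmx unitmxE unitfE det0 -!scalemxAr scalerA.
by rewrite expr2 mulfK.
Qed.

Lemma edge_coord0 x z : \det (edges x) = 0 -> edge_coord x z = 0.
Proof. by rewrite /edge_coord => ->; rewrite scale0r mulmx0. Qed.

Lemma edge_coord_neq0 x z : z != 0 -> \det (edges x) != 0 -> edge_coord x z != 0.
Proof.
move=> z0 det0; rewrite edge_coordE// scaler_eq0 expf_eq0/= (negbTE det0)/=.
apply: contra_neq z0 => z0; have edges_unit : edges x \in unitmx by rewrite unitmxE unitfE.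
by rewrite -[z](mulmxKV edges_unit) z0 mul0mx.
Qed.

(** The isometries of the hyperplane [sum0] that are applied to the columns of
    [vec_mx x] change the basis [edges x], but leave the corresponding point of
    [sum0] in the same direction. *)
Lemma normalize_edge_coord (Q : 'M[R]_d.+1) x z :
  Q *m Q^T = 1%:M -> (forall y, sum0 y -> sum0 (y *m Q)) ->
  normalize (edge_coord (mxvec (Q *m vec_mx x)) z *m D *m Q) =
  normalize (edge_coord x z *m D).
Proof.
move=> QQ UQ; pose B := D *m Q *m E.
have BD : B *m D = D *m Q.
  apply/row_matrixP => k; rewrite !row_mul.
  by apply: sum0_dropK; apply: UQ; rewrite -[row k D]mul1mx rowE mulmxA; exact: sum0_edge.
have Bunit : B \in unitmx.
  have : B *m (D *m Q^T *m E) = 1%:M.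
    by rewrite !mulmxA BD -(mulmxA D) QQ mulmx1 edge_drop_mx.
  by case/mulmx1_unit.
have detB : \det B != 0 by rewrite -unitfE -unitmxE.
have edgesB : edges (mxvec (Q *m vec_mx x)) = B *m edges x.
  by rewrite /edges mxvecK !mulmxA BD.
have [det0|det0] := eqVneq (\det (edges x)) 0.
  rewrite edge_coord0 ?edgesB ?det_mulmx ?det0 ?mulr0// edge_coord0//.
  by rewrite !mul0mx.
have edges_unit : edges x \in unitmx by rewrite unitmxE unitfE.
rewrite !edge_coordE// ?edgesB ?det_mulmx ?mulf_neq0//.
have BE_unit : B *m edges x \in unitmx by rewrite unitmx_mul Bunit.
have coordB : z *m invmx (B *m edges x) *m B = z *m invmx (edges x).
  by rewrite -[LHS](mulmxK edges_unit) -[_ *m B *m _]mulmxA mulmxKV.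
rewrite -!scalemxAl -mulmxA -BD mulmxA coordB !normalizeZ// exprn_even_gt0//=.
by rewrite mulf_neq0.
Qed.

Lemma measurable_edge_coord dT (T : measurableType dT)
    (f : T -> 'rV[R]_(d.+1 * d)) (g : T -> 'rV[R]_d) :
  measurable_fun setT f -> measurable_fun setT g ->
  measurable_mx (fun t => edge_coord (f t) (g t)).
Proof.
move=> mf mg; have mY : measurable_mx (fun t => edges (f t)).
  apply: measurable_mulmx; first exact: measurable_mx_cst.
  exact: measurable_vec_mx.
apply: measurable_mulmx; first exact: measurable_mx_rV.
by apply: measurable_scalemx; [exact: measurable_det|exact: measurable_adj].
Qed.

Lemma gaussian_prob_rotation (Q : 'M[R]_d.+1) A : Q *m Q^T = 1%:M -> measurable A ->
  gamma ((fun x => mxvec (Q *m vec_mx x)) @^-1` A) = gamma A.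
Proof.
move=> QQ mA; have QQ' := mulmx1C QQ.
apply: (@gaussian_prob_isometry _ _ _ (fun x => mxvec (Q^T *m vec_mx x))) => //.
- apply: measurable_mxvec; apply: measurable_mulmx; first exact: measurable_mx_cst.
  exact: measurable_vec_mx.
- by move=> x y; rewrite linearD mulmxDr linearD.
- by move=> x; rewrite mxvecK mulmxA QQ mul1mx vec_mxK.
- have normE x : enorm x ^+ 2 = \tr ((vec_mx x)^T *m vec_mx x : 'M[R]_d).
    rewrite enormE (reindex _ (curry_mxvec_bij d.+1 d))/= /mxtrace.
    under [RHS]eq_bigr do rewrite mxE.
    rewrite exchange_big pair_big/=; apply: eq_bigr => -[k l] _ /=.
    by rewrite !mxE expr2.
  move=> x; apply/eqP; rewrite -(eqrXn2 (n := 2)) ?enorm_ge0//.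
  by rewrite !normE mxvecK trmx_mul -mulmxA (mulmxA Q^T) QQ' mul1mx.
Qed.

(** For fixed [z], the point of [sum0] with the coordinates of [z] in the basis
    of the edges of a Gaussian simplex has a uniform direction. *)
Lemma uniform_edge_coord z : z != 0 ->
  exists2 mu : probability 'rV[R]_d.+1 R, uniform_on_unit_sphere (@sum0 R d) mu &
    forall A, measurable A ->
      mu A = gamma [set x | A (normalize (edge_coord x z *m D))].
Proof.
move=> z0.
have mc : measurable_fun setT (fun x => edge_coord x z *m D).
  apply: measurable_fun_rV => j.
  have mcoord := measurable_edge_coord (f := fun x => x) (g := fun=> z)
    (@measurable_id _ _ setT) (measurable_cst z).
  exact: (measurable_mulmx mcoord (measurable_mx_cst (T := 'rV[R]_(d.+1 * d)) D) ord0 j).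
pose c_mixin := isMeasurableFun.Build _ _ _ _ _ mc.
pose c : {RV gamma >-> 'rV[R]_d.+1} := HB.pack (fun x => edge_coord x z *m D) c_mixin.
pose N := [set x | \det (edges x) = 0].
apply: (@uniform_normalize R d.+1 _ _ gamma (@sum0 R d) c N).
- exact: linear_subspace_sum0.
- by apply: measurable_unit_sphere; exact: measurable_sum0.
- rewrite (_ : N = setT `&` (fun x => \det (edges x)) @^-1` [set 0]); last first.
    by rewrite setTI.
  apply: measurable_det => //; apply: measurable_mulmx.
    exact: measurable_mx_cst.
  exact: measurable_vec_mx.
- exact: (gaussian_prob_det0 (edge_drop_mx R i)).
- move=> x /= /eqP det0; split; first exact: sum0_edge.
  apply: contra_neq (edge_coord_neq0 z0 det0) => cD0.
  by rewrite -[LHS]mulmx1 -(edge_drop_mx R i) mulmxA cD0 mul0mx.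
- move=> Q QQ UQ; exists (fun x => mxvec (Q *m vec_mx x)).
    by move=> A mA; exact: gaussian_prob_rotation.
  by move=> x; exact: normalize_edge_coord.
Qed.

(** The cone of the regular simplex at its [i]th vertex. *)
Let cone := pos (fun j => @regular_simplex R d j - @regular_simplex R d i).

(** The vectors violating one of the inequalities that define the cone. *)
Let off_cone : set 'rV[R]_d.+1 := [set y | exists k, y ord0 (lift i k) < 0].

Let measurable_off_cone : measurable off_cone.
Proof.
rewrite (_ : off_cone = \bigcup_(k in [set: 'I_d])
    ((fun y : 'rV[R]_d.+1 => y ord0 (lift i k)) @^-1` `]-oo, 0[)).
  apply: fin_bigcup_measurable => // k _; rewrite -[X in measurable X]setTI.
  by apply: measurable_rV_coord => //; exact: measurable_itv.
apply/seteqP; split => y /=; first by case=> k yk; exists k; rewrite //= in_itv.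
by case=> k _; rewrite /= in_itv/= => yk; exists k.
Qed.

Let coneE : cone = @sum0 R d `&` ~` off_cone.
Proof.
rewrite /cone regular_coneE; apply/seteqP; split => y /= [y0 yk]; split => //.
  by move=> [k]; rewrite ltNge yk.
by move=> k; rewrite leNgt; apply/negP => yk0; apply: yk; exists k.
Qed.

Lemma measurable_regular_cone : measurable cone.
Proof.
rewrite coneE.
by apply: measurableI; [exact: measurable_sum0|exact: measurableC].
Qed.

(** By uniqueness, the direction of a random point as above falls in the cone of
    the regular simplex with a probability equal to its solid angle. *)
Lemma gaussian_prob_edge_coord_ge0 z : z != 0 ->
  gamma [set x | forall k, 0 <= edge_coord x z ord0 k] =
  uniform_sphere (@sum0 R d) cone.
Proof.
move=> z0; have [mu mu_unif muE] := uniform_edge_coord z0.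
have sigma_unif := uniform_sphereP mu_unif.
have mS : measurable (unit_sphere (@sum0 R d)).
  by apply: measurable_unit_sphere; exact: measurable_sum0.
have mcone := measurable_regular_cone.
have mu_cone mu' : uniform_on_unit_sphere (@sum0 R d) mu' ->
    mu' cone = (1 - mu' off_cone)%E.
  move=> mu'_unif; rewrite -probability_setC//.
  rewrite -(uniform_on_unit_sphereI mS mu'_unif)//.
  rewrite -[RHS](uniform_on_unit_sphereI mS mu'_unif)//; last exact: measurableC.
  congr (mu' _); rewrite coneE setIA; congr (_ `&` _).
  by apply/setIidl => y [].
have -> : [set x | forall k, 0 <= edge_coord x z ord0 k] =
    [set x | cone (normalize (edge_coord x z *m D))].
  rewrite /cone regular_coneE.
  have coordE x k : (normalize (edge_coord x z *m D)) ord0 (lift i k) =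
      (enorm (edge_coord x z *m D))^-1 * edge_coord x z ord0 k.
    rewrite mxE; congr (_ * _).
    by rewrite -mulmx_drop -mulmxA edge_drop_mx mulmx1.
  apply/seteqP; split => x /=.
    move=> xk; split; last first.
      by move=> k; rewrite coordE mulr_ge0// invr_ge0 enorm_ge0.
    by rewrite /normalize scalemxAl; exact: sum0_edge.
  move=> [_ xk] k; have [c0|c0] := eqVneq (edge_coord x z *m D) 0.
    suff -> : edge_coord x z = 0 by rewrite mxE.
    by rewrite -[LHS]mulmx1 -(edge_drop_mx R i) mulmxA c0 mul0mx.
  have := xk k; rewrite coordE pmulr_rge0// invr_gt0.
  by rewrite lt_neqAle enorm_ge0 eq_sym enorm_eq0 c0.
rewrite -muE// !mu_cone//; congr (_ - _)%E.
apply: (uniform_on_unit_sphere_unique (@linear_subspace_sum0 R d) mS) => //.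
(* the ball with radius the modulus of a negative coordinate *)
move=> x _ [k xk]; exists (- x ord0 (lift i k)); first by rewrite oppr_gt0.
move=> y _ xy; exists k; rewrite ltNge; apply/negP => yk.
have : `|(x - y) ord0 (lift i k)| <= enorm (x - y).
  rewrite -ler_sqr ?nnegrE ?enorm_ge0// real_normK ?num_real// enormE.
  rewrite (bigD1 (lift i k))//= lerDl sumr_ge0// => j _; exact: sqr_ge0.
rewrite !mxE ler0_norm; last by lra.
by move=> h; lra.
Qed.

End gaussian_cone.

(** * The expected sum of the solid angles *)

(** Integrals of nonnegative functions that agree off a negligible set are equal
    as soon as one of the functions is measurable; the other one need not be. *)
Lemma ge0_integral_eq_off_null (R : realType) (dT : measure_display)
    (T : measurableType dT) (mu : {measure set T -> \bar R}) (N : set T)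
    (f g : T -> \bar R) :
  measurable N -> mu N = 0%E -> measurable_fun setT g ->
  (forall t, 0 <= f t)%E -> (forall t, 0 <= g t)%E ->
  (forall t, ~ N t -> f t = g t) ->
  (\int[mu]_t f t = \int[mu]_t g t)%E.
Proof.
move=> mN N0 mg f0 g0 fg.
have int_le (f1 f2 : T -> \bar R) : (forall t, 0 <= f1 t)%E ->
    (forall t, f1 t <= f2 t)%E -> (\int[mu]_t f1 t <= \int[mu]_t f2 t)%E.
  move=> f10 f12; rewrite !ge0_integralTE//; last first.
    by move=> t; exact: le_trans (f10 t) (f12 t).
  apply: ereal_sup_le => _ [h hf1 <-]; exists h => // t.
  exact: le_trans (hf1 t) (f12 t).
pose g1 := g \_ (~` N).
pose g2 t := (g t + (cst +oo \_ N) t)%E.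
have mg1 : measurable_fun setT g1.
  by apply/(measurable_restrictT _ _).1; [exact: measurableC|exact: measurable_funTS].
have mg2 : measurable_fun setT g2.
  apply: emeasurable_funD => //.
  by apply/(measurable_restrictT _ _).1 => //; exact: measurable_cst.
have g10 t : (0 <= g1 t)%E by apply: erestrict_ge0 => ? _; exact: g0.
have g20 t : (0 <= g2 t)%E.
  by apply: adde_ge0 => //; apply: erestrict_ge0 => ? _; exact: leey.
have offN1 t : ~ N t -> g1 t = g t by move=> Nt; rewrite /g1 patchE mem_set.
have offN2 t : ~ N t -> g2 t = g t.
  by move=> Nt; rewrite /g2 patchE memNset// adde0.
have int1 : (\int[mu]_t g1 t = \int[mu]_t g t)%E.
  apply: ge0_ae_eq_integral => //; exists N; split => // t /= /not_implyP[_ /= gt].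
  by apply: contrapT => Nt; apply: gt; exact: offN1.
have int2 : (\int[mu]_t g2 t = \int[mu]_t g t)%E.
  apply: ge0_ae_eq_integral => //; exists N; split => // t /= /not_implyP[_ /= gt].
  by apply: contrapT => Nt; apply: gt; exact: offN2.
apply/eqP; rewrite eq_le -{1}int2 -int1; apply/andP; split; apply: int_le => // t.
  have [Nt|Nt] := pselect (N t); last by rewrite fg// offN2.
  by rewrite /g2 patchE mem_set//= addey ?leey// gt_eqF// (lt_le_trans _ (g0 t)) ?ltNy0.
have [Nt|Nt] := pselect (N t); last by rewrite fg// offN1.
by rewrite /g1 patchE memNset//; apply.
Qed.

Lemma solid_angle_ge0 (R : realType) n (C : set 'rV[R]_n) : 0 <= solid_angle C.
Proof. exact/fine_ge0/measure_ge0. Qed.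

Section angles.
Variables (R : realType) (d : nat).
Hypothesis d1 : (1 <= d)%N.
Implicit Types (x : 'rV[R]_(d.+1 * d)) (z : 'rV[R]_d) (i : 'I_d.+1).

Let sigma := uniform_sphere [set: 'rV[R]_d].

(** Almost everywhere, the solid angle at the [i]th vertex of the simplex whose
    vertices are the rows of [vec_mx x]. *)
Definition angle_at i x : \bar R :=
  sigma [set z | forall k, 0 <= edge_coord i x z ord0 k].

Let measurable_cone i : measurable
  [set p : 'rV[R]_(d.+1 * d) * 'rV[R]_d |
     forall k, 0 <= edge_coord i p.1 p.2 ord0 k].
Proof.
rewrite (_ : [set p | _] = \bigcap_(k in [set: 'I_d])
    ((fun p : 'rV[R]_(d.+1 * d) * 'rV[R]_d => edge_coord i p.1 p.2 ord0 k)
      @^-1` `[0, +oo[)).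
  apply: fin_bigcap_measurable => // k _; rewrite -[X in measurable X]setTI.
  have mcoord := measurable_edge_coord i
    (@measurable_fst _ _ 'rV[R]_(d.+1 * d) 'rV[R]_d) measurable_snd.
  by apply: mcoord => //; exact: measurable_itv.
apply/seteqP; split => p /= h k; first by move=> _; rewrite /= in_itv/= andbT.
by have := h k I; rewrite /= in_itv/= andbT.
Qed.

Lemma measurable_angle_at i : measurable_fun setT (angle_at i).
Proof. exact: (measurable_slice sigma (measurable_cone i)). Qed.

Lemma angle_atE i x : \det (edges i x) != 0 ->
  (solid_angle_at (fun j => row j (vec_mx x)) i)%:E = angle_at i x.
Proof.
move=> det0; have edges_unit : edges i x \in unitmx by rewrite unitmxE unitfE.
rewrite /solid_angle_at /solid_angle (_ : lin _ = setT).
  suff -> : pos (fun j => row j (vec_mx x) - row i (vec_mx x)) =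
      [set z | forall k, 0 <= edge_coord i x z ord0 k].
    rewrite fineK// fin_num_measure//.
    have := measurable_xsection x (measurable_cone i).
    by rewrite /xsection; under eq_set do rewrite inE.
  rewrite pos_edges; apply/seteqP; split => z /=.
    move=> [a a0 ->] k; rewrite edge_coordE// mulmxK// mxE mulr_ge0//.
    exact: sqr_ge0.
  move=> zk; exists (z *m invmx (edges i x)); last by rewrite mulmxKV.
  move=> k; have := zk k; rewrite edge_coordE// mxE pmulr_rge0//.
  by rewrite exprn_even_gt0.
rewrite lin_edges; apply/seteqP; split => // z _ /=.
by exists (z *m invmx (edges i x)); rewrite mulmxKV.
Qed.

(** By Tonelli's theorem, the point [z] of the sphere can be fixed first, and
    then the average over [x] is the angle of the regular simplex for every
    [z != 0]. *)
Lemma integral_angle_at i :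
  (\int[@gaussian_prob R (d.+1 * d)]_x angle_at i x =
   (solid_angle_at (@regular_simplex R d) i)%:E)%E.
Proof.
rewrite /solid_angle_at /solid_angle lin_regular_cone.
set tau := uniform_sphere (@sum0 R d).
set C := pos _.
rewrite [LHS](slice_swap (@gaussian_prob R (d.+1 * d)) sigma (measurable_cone i)).
have [sigma1 _] := uniform_on_unit_sphereT R d1.
have m0 : measurable [set 0 : 'rV[R]_d] by exact: measurable_rV_zero.
have sigma0 : sigma [set 0] = 0%E.
  apply/eqP; rewrite -measure_le0 -(@subee _ 1%E)// -[X in (_ <= _ - X)%E]sigma1.
  rewrite -probability_setC; last by apply: measurable_unit_sphere.
  apply: le_measure; rewrite ?inE//.
    by apply: measurableC; apply: measurable_unit_sphere.
  move=> _ -> [_ /=]; apply/eqP.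
  by rewrite (eqP (_ : enorm 0 == 0)) ?enorm_eq0// eq_sym oner_eq0.
transitivity (\int[sigma]_z (tau C))%E.
  apply: ge0_integral_eq_off_null m0 sigma0 _ _ _ _ => //.
  by move=> z z0; apply: gaussian_prob_edge_coord_ge0; apply/eqP.
rewrite integral_cst// fineK; last first.
  by apply: fin_num_measure; exact: measurable_regular_cone.
by rewrite -[RHS]mule1; congr (_ * _)%E; exact: probability_setT.
Qed.

End angles.

Section expectation.
Variables (R : realType) (dT : measure_display) (T : measurableType dT).
Variables (P : probability T R) (d : nat) (X : 'I_d.+1 -> {RV P >-> 'rV[R]_d}).

Lemma integral_joint_row (f : 'rV[R]_(d.+1 * d) -> \bar R) :
  independent X -> (forall i, standard_gaussian (X i)) ->
  measurable_fun setT f -> (forall x, 0 <= f x)%E ->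
  (\int[P]_w f (joint_row X w) = \int[@gaussian_prob R (d.+1 * d)]_x f x)%E.
Proof.
move=> indX gaussX mf f0.
pose Jm := isMeasurableFun.Build _ _ _ _ _ (measurable_joint_row X).
pose J : {RV P >-> 'rV[R]_(d.+1 * d)} := HB.pack (joint_row X) Jm.
rewrite -(@ge0_integral_distribution _ _ _ _ _ _ J)//.
by apply: eq_measure_integral => A mA _; exact (joint_row_law indX gaussX mA).
Qed.

End expectation.


Theorem theorem1p1 (R : realType) (dT : measure_display)
  (T : measurableType dT) (P : probability T R) (d : nat)
  (X : 'I_d.+1 -> {RV P >-> 'rV[R]_d}) :
  (1 <= d)%N ->
  independent X ->
  (forall i, standard_gaussian (X i)) ->
  ('E_P[fun w => solid_angle_sum (fun i => X i w)] =
     (solid_angle_sum (@regular_simplex R d))%:E)%E.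
Proof.
move=> d1 indX gaussX.
(* the solid angles of a degenerate simplex are not controlled, not even for
   measurability, so the integrand is replaced off the null set [N] *)
pose flat i := [set x : 'rV[R]_(d.+1 * d) | \det (edges i x) = 0].
have mflat i : measurable (flat i).
  rewrite (_ : flat i = setT `&` (fun x => \det (edges i x)) @^-1` [set 0]); last first.
    by rewrite setTI.
  apply: measurable_det => //; apply: measurable_mulmx.
    exact: measurable_mx_cst.
  exact: measurable_vec_mx.
have mjoint := measurable_joint_row X.
pose N := \big[setU/set0]_(i < d.+1) (joint_row X @^-1` flat i).
have mNi i : measurable (joint_row X @^-1` flat i).
  by rewrite -[X in measurable X]setTI; exact: mjoint.
have [mN N0] : measurable N /\ P N = 0%E.
  apply: (big_ind (fun A => measurable A /\ P A = 0%E)); first by rewrite measure0.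
    move=> A B [mA A0] [mB B0]; split; first exact: measurableU.
    exact: null_set_setU.
  move=> i _; split=> //; rewrite joint_row_law//.
  exact: (gaussian_prob_det0 (edge_drop_mx R i)).
have mangle i : measurable_fun setT (fun w => angle_at i (joint_row X w)).
  exact: measurableT_comp (measurable_angle_at i) mjoint.
have edgesX w : (fun i => X i w) = (fun i => row i (vec_mx (joint_row X w))).
  by apply/funext => i; rewrite mxvecK rowK.
rewrite unlock (ge0_integral_eq_off_null mN N0
  (g := fun w => (\sum_(i < d.+1) angle_at i (joint_row X w))%E)); first last.
- move=> w Nw; rewrite /solid_angle_sum -sumEFin; apply: eq_bigr => i _.
  rewrite edgesX angle_atE//; apply/eqP => det0; apply: Nw.
  by rewrite /N -bigcup_seq; exists i => //=; rewrite mem_index_enum.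
- by move=> w; apply: sume_ge0 => i _; exact: measure_ge0.
- by move=> w; rewrite lee_fin sumr_ge0// => i _; exact: solid_angle_ge0.
- exact: emeasurable_sum.
rewrite ge0_integral_sum//.
rewrite /solid_angle_sum -sumEFin; apply: eq_bigr => i _.
rewrite (integral_joint_row indX gaussX (measurable_angle_at i))//.
exact: integral_angle_at.
Qed.
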